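(* Let $A\in\mathbb{R}_{\min}^{n\times n}$ be an irreducible matrix. Let $\Gamma=(\gamma_1\leq\cdots\leq\gamma_n)$ be the sequence of roots of the min-plus characteristic polynomial of $A$, and let $\beta=(\beta_1\leq\cdots\leq\beta_n)$ be the sequence of critical values of $A$ repeated with multiplicities. For all $\ell\in\{1,\ldots,k\}$, where $k$ is the number of critical values of $A$, the following assertions are equivalent: (1) $\gamma_j=\beta_j$ for $j\in\{\#C^{\ell-1}+1,\ldots,\#C^\ell\}$, and $\gamma_1+\cdots+\gamma_{\#C^{\ell-1}}=\beta_1+\cdots+\beta_{\#C^{\ell-1}}$; (2) $G^c_{\ell-1}(A)$ and $G^c_\ell(A)$ have a disjoint circuit cover.
   Context: The min-plus semiring $\mathbb{R}_{\min}$ is $\mathbb{R}\cup\{+\infty\}$ with addition $a\oplus b=\min(a,b)$ and multiplication $ab=a+b$ (zero element $+\infty$, unit $0$); matrix operations are taken in this sense. For a finite set $L$ and an $L\times L$ matrix $B$ over $\mathbb{R}_{\min}$, $G(B)$ is the digraph with node set $L$ and an arc $(i,j)$ whenever $B_{ij}\neq+\infty$; $B$ is irreducible if $G(B)$ is strongly connected. (When $n=1$, the matrix $(+\infty)$ is excluded, so that critical values are real.) For a path $p=(i_0,\ldots,i_k)$, $|p|_B=\sum_m B_{i_mi_{m+1}}$ and $|p|=k$. $\rho_{\min}(B)=\min_c|c|_B/|c|$ over circuits $c$ of $G(B)$ ($+\infty$ if there are none); a circuit is critical if it attains this minimum; its nodes are called critical nodes of $B$. Min-plus Schur complement: for $C\subset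 L$, $N=L\setminus C$ and $\lambda\in\mathbb{R}$ with $\lambda\leq\rho_{\min}(B_{CC})$, $\mathrm{Schur}(C,\lambda,B)=B_{NN}\oplus B_{NC}(\lambda^{-1}B_{CC})^*\lambda^{-1}B_{CN}$ (an $N\times N$ matrix), where $\lambda^{-1}M$ is $M$ with $\lambda$ subtracted from every entry and $M^*=I\oplus M\oplus M^2\oplus\cdots$. Critical values of an irreducible $A$: put $A_1=A$ and, for $\ell\geq1$, $\alpha_\ell=\rho_{\min}(A_\ell)$, $C_\ell$ the set of critical nodes of $A_\ell$, and, as long as $C_1\cup\cdots\cup C_\ell\neq\{1,\ldots,n\}$, $A_{\ell+1}=\mathrm{Schur}(C_\ell,\alpha_\ell,A_\ell)$. This stops at some $k\leq n$; $C_1,\ldots,C_k$ partition $\{1,\ldots,n\}$ and $\alpha_1<\cdots<\alpha_k$ are the critical values of $A$, $\alpha_\ell$ having multiplicity $\#C_\ell$. Repeating each with its multiplicity gives $\beta$. Put $C^0=\emptyset$, $C^\ell=C_1\cup\cdots\cup C_\ell$, $N^\ell=\{1,\ldots,n\}\setminus C^{\ell-1}$. For a set $C$ of nodes, $|p|_C$ is the number of arcs of the path $p$ with initial node in $C$. For a path $p$ of $G(A)$, $|p|^\ell_A=|p|_A-\alpha_1|p|_{C_1}-\cdots-\alpha_{\ell-1}|p|_{C_{\ell-1}}$ and $|p|^\ell=|p|_{N^\ell}$. A circuit $c$ of $G(A)$ is critical of order $\ell$ if $|c|^\ell_A=\alpha_\ell|c|^\ell$; $G^c_\ell(A)$ is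 the graph whose nodes and arcs are those belonging to critical circuits of order $\ell$. A graph has a disjoint circuit cover if there is a disjoint union of (elementary) circuits of the graph, loops allowed, containing all its nodes. By convention $G^c_0(A)$ is the empty graph, and it has a disjoint circuit cover. The min-plus characteristic polynomial of $A$ is $P=\bigoplus_{j=0}^nP_j\mathsf{Y}^j$ with $P_n=0$ and, for $1\le m\le n$, $P_{n-m}=\min_{\#J=m}\min_{\sigma\in\mathfrak{S}_J}\sum_{j\in J}A_{j\sigma(j)}$ ($J\subset\{1,\ldots,n\}$, $\mathfrak{S}_J$ the permutations of $J$). The roots of $P$ are the unique $\gamma_1\leq\cdots\leq\gamma_n$ in $\mathbb{R}\cup\{+\infty\}$ with $\min_k(P_k+ky)=P_n+\sum_i\min(y,\gamma_i)$ for all $y$. *)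

(* Defs.v *)
From mathcomp Require Import all_boot all_order all_algebra perm.
From mathcomp Require Import boolp classical_sets reals constructive_ereal ereal.

Set Implicit Arguments.
Unset Strict Implicit.
Unset Printing Implicit Defensive.

Import Order.TTheory GRing.Theory Num.Theory.

Local Open Scope ring_scope.
Local Open Scope ereal_scope.

(* The min-plus semiring R u {+oo} is the part of \bar R avoiding -oo: its sum  *)
(* is mine (zero +oo) and its product is + (unit 0).                            *)

Record digraph (T : finType) := Digraph { nodes : {set T}; arcs : rel T }.

Section Digraphs.
Variable T : finType.
Implicit Types (G : digraph T) (c : seq T).

Definition strongly_connected G : Prop :=
  {in nodes G &, forall i j, connect (arcs G) i j}.

(* The circuit (i_0, ..., i_k) with i_k = i_0 is encoded as the sequence        *)
(* [:: i_0; ...; i_(k-1)]; it is elementary when this sequence is uniq.         *)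
(* Its length k is then size c.                                                 *)
Definition circuit G c : bool :=
  [&& c != [::], all (mem (nodes G)) c & cycle (arcs G) c].

Definition circuit_arcs c : seq (T * T) := zip c (rot 1 c).

(* |c|_C *)
Definition arcs_from (C : {set T}) c : nat :=
  count (fun a => a.1 \in C) (circuit_arcs c).

Definition disjoint_circuit_cover G : Prop :=
  exists cs : seq (seq T),
    [/\ all (circuit G) cs, uniq (flatten cs) & {subset nodes G <= flatten cs}].

Definition empty_digraph : digraph T := Digraph finset.set0 (fun _ _ => false).

End Digraphs.

Section MinPlus.
Variables (R : realType) (n : nat).
Implicit Types (A B M : 'M[\bar R]_n) (L C : {set 'I_n}).

(* A min-plus matrix indexed by a subset L of 'I_n is represented by a full     *)
(* n x n matrix together with L; entries outside L x L are never used.          *)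

Definition mp_graph L B : digraph 'I_n :=
  Digraph L (fun i j => [&& i \in L, j \in L & B i j != +oo]).

Definition mp_irreducible A : Prop := strongly_connected (mp_graph [set: 'I_n] A).

(* |c|_B *)
Definition weight B (c : seq 'I_n) : \bar R :=
  \sum_(a <- circuit_arcs c) B a.1 a.2.

Definition mean_weight B (c : seq 'I_n) : \bar R :=
  weight B c * ((size c)%:R^-1)%:E.

(* The infimum is +oo when there is no circuit.                                 *)
Definition rho_min L B : \bar R :=
  ereal_inf [set mean_weight B c | c in [set c | circuit (mp_graph L B) c]]%classic.

Definition critical_circuit L B (c : seq 'I_n) : Prop :=
  circuit (mp_graph L B) c /\ mean_weight B c = rho_min L B.

Definition critical_nodes L B : {set 'I_n} :=
  [set i | `[< exists2 c, critical_circuit L B c & i \in c >]].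

(* Product of M restricted to columns in C by B restricted to rows in C.        *)
Definition mp_mul C M B : 'M[\bar R]_n :=
  \matrix_(i, j) \big[mine/+oo]_(k in C) (M i k + B k j).

Definition mp_one : 'M[\bar R]_n := \matrix_(i, j) (if i == j then 0 else +oo).

Definition mp_star C M : 'M[\bar R]_n :=
  \matrix_(i, j) ereal_inf (range (fun p : nat => iter p (mp_mul C M) mp_one i j)).

(* lambda^-1 M *)
Definition mp_unscale (lambda : R) M : 'M[\bar R]_n :=
  \matrix_(i, j) (M i j - lambda%:E).

(* On a node set L containing C, the result is meaningful on N = L \ C.         *)
Definition mp_schur C (lambda : R) B : 'M[\bar R]_n :=
  let B' := mp_unscale lambda B in
  \matrix_(i, j) mine (B i j) (mp_mul C (mp_mul C B (mp_star C B')) B' i j).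

Section CriticalValues.
Variable A : 'M[\bar R]_n.

(* stage m is the pair (C^m, A_(m+1)).  Once C^m is the whole node set it is    *)
(* stationary in its first component.  All families below are indexed by l >= 1 *)
(* except Ccum, where Ccum l is C^l; Nrem l is N^l, Amat l is A_l, Ccrit l is   *)
(* C_l.  The stopping criterion is in ncrit.                                    *)
Definition stage (m : nat) : {set 'I_n} * 'M[\bar R]_n :=
  iter m
    (fun s => let C := critical_nodes (~: s.1) s.2 in
              (s.1 :|: C, mp_schur C (fine (rho_min (~: s.1) s.2)) s.2))
    (finset.set0, A).

Definition Ccum (l : nat) : {set 'I_n} := (stage l).1.
Definition Nrem (l : nat) : {set 'I_n} := ~: Ccum l.-1.
Definition Amat (l : nat) : 'M[\bar R]_n := (stage l.-1).2.
Definition Ccrit (l : nat) : {set 'I_n} := critical_nodes (Nrem l) (Amat l).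
Definition alpha (l : nat) : R := fine (rho_min (Nrem l) (Amat l)).

(* The number k of critical values: those l in 1 .. n for which C^(l-1) is not  *)
(* yet the whole node set.                                                      *)
Definition ncrit : nat := count (fun l => Nrem l != finset.set0) (iota 1 n).

Definition critical_values : seq R :=
  flatten [seq nseq #|Ccrit l| (alpha l) | l <- iota 1 ncrit].

(* |c|^l_A *)
Definition order_weight (l : nat) (c : seq 'I_n) : \bar R :=
  weight A c - (\sum_(1 <= m < l) alpha m * (arcs_from (Ccrit m) c)%:R)%R%:E.

Definition order_critical (l : nat) (c : seq 'I_n) : Prop :=
  circuit (mp_graph [set: 'I_n] A) c /\
  order_weight l c = (alpha l * (arcs_from (Nrem l) c)%:R)%R%:E.

(* G^c_l(A) *)
Definition critical_graph (l : nat) : digraph 'I_n :=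
  if l is 0%N then empty_digraph _ else
  Digraph [set i | `[< exists2 c, order_critical l c & i \in c >]]
    (fun i j => `[< exists2 c, order_critical l c & (i, j) \in circuit_arcs c >]).

(* P_k; for k = n only the empty J contributes and the value is 0.              *)
Definition charpoly_coef (k : nat) : \bar R :=
  \big[mine/+oo]_(J : {set 'I_n} | #|J| == (n - k)%N)
    \big[mine/+oo]_(s : {perm 'I_n} | perm_on J s) \sum_(j in J) A j (s j).

Definition charpoly_roots (gamma : 'I_n -> \bar R) : Prop :=
  [/\ forall i, gamma i != -oo,
      forall i j : 'I_n, (i <= j)%N -> gamma i <= gamma j
    & forall y : R,
        \big[mine/+oo]_(k < n.+1) (charpoly_coef k + (k%:R * y)%:E) =
        charpoly_coef n + \sum_(i < n) mine y%:E (gamma i)].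

End CriticalValues.

End MinPlus.

(* Main.v *)
Require Import Defs.
From mathcomp Require Import all_boot all_order all_algebra perm.
From mathcomp Require Import boolp classical_sets reals constructive_ereal ereal.
From mathcomp Require Import ring lra zify.

(** Let every node x carry the value d x = alpha_m, where m is the index with
    x in C_m.  The whole theorem rests on one certificate: a real potential v with

      A i j >= d i + v j - v i   for all i, j,                              (P)

    such that, for each l, every node of C^l lies on a closed walk that stays
    inside C^l and along which (P) is an equality.  Call such arcs saturated.

    Consequences for graphs.  Summing (P) along a circuit telescopes v away, so a
    circuit c weighs at least the sum of d over c, with equality exactly when all
    its arcs are saturated.  Since alpha is increasing, the circuits that are
    critical of order l are the circuits of saturated arcs inside C^l
    ([order_criticalP]); hence G^c_l(A) has node set C^l, and a disjoint circuit
    cover of it is a permutation of C^l all of whose arcs are saturated, that is,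
    a permutation of C^l of weight at most the sum of d over C^l
    ([cover_perm_weight]).

    Consequences for roots.  The polynomial function at y is the least value of
    w(s) + (n - #J) y over all J and all permutations s of J, w(s) being the
    weight of s, and it equals the sum of the min(y, gamma_i).  By (P) this is at
    least the sum of the min(y, d x).  For y strictly between alpha_m and
    alpha_(m+1), that minimum of d-sums is attained at J = C^m only.  Comparing
    both sides at such a y shows that the first #C^m roots add up to the first
    #C^m critical values if and only if G^c_m(A) has a disjoint circuit cover
    ([roots_sum_cover]).  Assertion (1) of the theorem is this equality of sums
    for both m = l - 1 and m = l: when it holds for l - 1, all later roots are at
    least alpha_l ([next_root_ge]), and the sum over the block of level l then
    forces each of its roots to be alpha_l.

    Existence of the certificate.  For a single matrix with minimal circuit mean
    lambda, shortest distances give a potential with d constant equal to lambda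
    ([potential_exists]), and the minimal mean is attained.  Elimination of the
    critical nodes by a Schur complement respects potentials in both directions:
    a potential of B is one of its Schur complement, a saturated arc of the Schur
    complement unfolding into a walk of saturated arcs of B
    ([schur_potential], [schur_saturated]); conversely a potential of the Schur
    complement extends to the eliminated nodes ([potential_extend]).  The first
    direction gives the strict increase of alpha and the saturated closed walks;
    the second one, applied from the last stage back to the first, gives v
    ([critical_potential]). *)

Set Implicit Arguments.
Unset Strict Implicit.
Unset Printing Implicit Defensive.

Import Order.TTheory GRing.Theory Num.Theory.

Local Open Scope ring_scope.
Local Open Scope ereal_scope.

(** * Sums and minima of extended reals *)

Section ExtendedReals.
Variable R : realType.
Implicit Types (x y : \bar R) (r : R).

Lemma bigmine_attained (I : finType) (P : pred I) (F : I -> \bar R) :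
  \big[mine/+oo]_(i | P i) F i = +oo \/
  exists2 i, P i & \big[mine/+oo]_(i | P i) F i = F i.
Proof.
elim/big_ind: _ => [|x y IHx IHy|i Pi]; [by left | | by right; exists i].
by case: (leP x y) => _.
Qed.

Lemma lee_sum_fin (I : eqType) (s : seq I) (F : I -> \bar R) (g : I -> R) :
  {in s, forall i, (g i)%:E <= F i} ->
  (\sum_(i <- s) g i)%:E <= \sum_(i <- s) F i.
Proof.
move=> gF; rewrite -sumEFin big_seq [leRHS]big_seq.
by apply: lee_sum => i; apply: gF.
Qed.

(** If real lower bounds of the terms already add up to the sum, no term can
    exceed its bound: this is how equality of total weights is turned into
    saturation of every single arc. *)
Lemma lee_sum_tight (I : eqType) (s : seq I) (F : I -> \bar R) (g : I -> R) :
  {in s, forall i, (g i)%:E <= F i} ->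
  \sum_(i <- s) F i <= (\sum_(i <- s) g i)%:E ->
  {in s, forall i, F i = (g i)%:E}.
Proof.
elim: s => [|i s IHs] gF; first by [].
have gi : (g i)%:E <= F i by apply: gF; rewrite mem_head.
have gs : {in s, forall j, (g j)%:E <= F j}.
  by move=> j js; apply: gF; rewrite inE js orbT.
have sum_s := lee_sum_fin gs.
rewrite !big_cons EFinD => le_s.
have Fi : F i = (g i)%:E.
  apply/eqP; rewrite eq_le gi andbT leNgt; apply/negP => lt_i.
  by move: le_s; rewrite leNgt lte_leD.
move=> j; rewrite inE => /predU1P[-> //|]; apply: IHs => //.
by move: le_s; rewrite Fi leeD2lE.
Qed.

Lemma finite_ub (I : finType) (f : I -> R) : exists K, forall i, (f i <= K)%R.
Proof.
exists (\sum_i `|f i|)%R => i.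
rewrite (bigD1 i) //= (le_trans (ler_norm _)) // lerDl.
by apply: sumr_ge0 => j _.
Qed.

(** A finite family of reals is bounded away from zero on its positive
    members; this replaces attainment of the infimum in the Kleene star. *)
Lemma finite_gap (I : finType) (f : I -> R) :
  exists2 delta, (0 < delta)%R & forall i, (0 < f i)%R -> (delta <= f i)%R.
Proof.
exists (\big[Num.min/1%R]_(i | (0 < f i)%R) f i).
  by apply: lt_bigmin.
by move=> i fi; apply: bigmin_le_cond.
Qed.

End ExtendedReals.

(** * Closed walks and sums along circuits *)

Section Circuits.
Variable T : finType.
Implicit Types (e : rel T) (c s : seq T).

(** Walks with at least one arc, unlike [connect], which is reflexive. *)
Definition tclosure e : rel T := fun x y => [exists z, e x z && connect e z y].

Lemma tclosure1 e x y : e x y -> tclosure e x y.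
Proof. by move=> exy; apply/existsP; exists y; rewrite exy connect0. Qed.

Lemma tclosure_connect e x y : tclosure e x y -> connect e x y.
Proof. by case/existsP=> z /andP[/connect1]; apply: connect_trans. Qed.

Lemma tclosure_trans_r e x y z :
  tclosure e x y -> connect e y z -> tclosure e x z.
Proof.
case/existsP=> w /andP[exw ewy] eyz; apply/existsP; exists w.
by rewrite exw (connect_trans ewy).
Qed.

Lemma tclosure_sub e e' x y :
  (forall u v, e u v -> tclosure e' u v) -> tclosure e x y -> tclosure e' x y.
Proof.
move=> ee'; case/existsP=> z /andP[/ee' e'xz ezy].
apply: tclosure_trans_r e'xz _; apply: connect_sub ezy => u v.
by move/ee'/tclosure_connect.
Qed.

Lemma tclosure_cycle e x : tclosure e x x -> exists2 c, cycle e c & x \in c.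
Proof.
case/existsP=> z /andP[exz /connectP[p ep xp]].
exists (z :: p); last by rewrite xp mem_last.
by rewrite /= rcons_path ep -xp.
Qed.

Lemma cycle_tclosure e c x : cycle e c -> x \in c -> tclosure e x x.
Proof.
move=> ec xc; apply/existsP; exists (next c x).
by rewrite (next_cycle ec) // (connect_cycle ec) // mem_next.
Qed.

Lemma path_zipE e x y s :
  path e x (rcons s y) =
  all (fun a => e a.1 a.2) (zip (x :: s) (rcons s y)).
Proof. by elim: s x => [|z s IHs] x //=; rewrite IHs. Qed.

Lemma cycle_arcsE e c : cycle e c = all (fun a => e a.1 a.2) (circuit_arcs c).
Proof. by case: c => [|x s] //; rewrite /circuit_arcs rot1_cons -path_zipE. Qed.

Lemma circuit_arcs_mem c a : a \in circuit_arcs c -> (a.1 \in c) && (a.2 \in c).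
Proof.
rewrite /circuit_arcs => ac.
have [s1 s2] : size c = size (rot 1 c) /\ size (rot 1 c) = size c.
  by rewrite size_rot.
have := map_f (fun b => b.1) ac; have := map_f (fun b => b.2) ac.
rewrite -/unzip1 -/unzip2 -/(unzip1 _) -/(unzip2 _).
by rewrite unzip1_zip ?unzip2_zip ?mem_rot ?s1 // => -> ->.
Qed.

Variable V : nmodType.

Lemma sum_arcs1 c (f : T -> V) :
  (\sum_(a <- circuit_arcs c) f a.1 = \sum_(x <- c) f x)%R.
Proof. by rewrite -(big_map fst xpredT f) -/(unzip1 _) unzip1_zip ?size_rot. Qed.

Lemma sum_arcs2 c (f : T -> V) :
  (\sum_(a <- circuit_arcs c) f a.2 = \sum_(x <- c) f x)%R.
Proof.
rewrite -(big_map snd xpredT f) -/(unzip2 _) unzip2_zip ?size_rot //.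
by apply: perm_big; rewrite perm_rot.
Qed.

Lemma arcs_fromE (C : {set T}) c : arcs_from C c = (\sum_(x <- c) (x \in C))%N.
Proof.
rewrite /arcs_from -(count_map fst (mem C)) -/(unzip1 _) unzip1_zip ?size_rot //.
by elim: c => [|x s IHs] /=; rewrite ?big_nil // big_cons -IHs.
Qed.

End Circuits.

(** The differences of v telescope because the end nodes of the arcs of a
    circuit are a rotation of their initial nodes. *)
Lemma sum_arcs_potential (T : finType) (R : realType) (c : seq T) (d v : T -> R) :
  (\sum_(a <- circuit_arcs c) (d a.1 + v a.2 - v a.1) = \sum_(x <- c) d x)%R.
Proof.
by rewrite !big_split /= sumrN (sum_arcs1 c d) (sum_arcs1 c v) (sum_arcs2 c v) addrK.
Qed.

(** * Potentials and shortest walks *)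

Section Potentials.
Variables (R : realType) (n : nat).
Implicit Types (B M : 'M[\bar R]_n) (L C : {set 'I_n}) (d u v : 'I_n -> R).
Implicit Types (c s : seq 'I_n) (lambda : R).

(** The values d are charged to the initial node of an arc, as in |c|_C. *)
Definition potential L B d v :=
  {in L &, forall i j, (d i + v j - v i)%:E <= B i j}.

Definition saturated L B d v : rel 'I_n := fun i j =>
  [&& i \in L, j \in L & B i j == (d i + v j - v i)%:E].

Lemma potentialS L L' B d v :
  L' \subset L -> potential L B d v -> potential L' B d v.
Proof. by move=> /fintype.subsetP sL p i j /sL iL /sL jL; apply: p. Qed.

Section CircuitWeights.
Variables (L : {set 'I_n}) (B : 'M[\bar R]_n) (d v : 'I_n -> R).
Hypothesis pot : potential L B d v.
Variable c : seq 'I_n.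
Hypothesis cL : {subset c <= L}.

Let arcs_pot : {in circuit_arcs c, forall a,
  (d a.1 + v a.2 - v a.1)%:E <= B a.1 a.2}.
Proof. by move=> a /circuit_arcs_mem/andP[? ?]; apply: pot; apply: cL. Qed.

Lemma weight_ge : (\sum_(i <- c) d i)%:E <= weight B c.
Proof. by rewrite -(sum_arcs_potential c d v); apply: lee_sum_fin arcs_pot. Qed.

Lemma weight_tight :
  reflect (weight B c = (\sum_(i <- c) d i)%:E) (cycle (saturated L B d v) c).
Proof.
rewrite -(sum_arcs_potential c d v) cycle_arcsE; apply: (iffP allP).
  move=> sat; rewrite /weight -sumEFin; apply: eq_big_seq => a /sat.
  by case/and3P=> _ _ /eqP.
move=> wc a ac; have /andP[? ?] := circuit_arcs_mem ac.
apply/and3P; split; [exact: cL | exact: cL | apply/eqP].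
by apply: (lee_sum_tight arcs_pot _ ac); rewrite -wc.
Qed.

End CircuitWeights.

Section Existence.
Variables (L : {set 'I_n}) (B : 'M[\bar R]_n) (lambda : R).
Hypothesis B_ninfty : {in L &, forall i j, B i j != -oo}.

Fixpoint walk_weight (i : 'I_n) (s : seq 'I_n) : \bar R :=
  if s is j :: s' then B i j - lambda%:E + walk_weight j s' else 0.

Lemma walk_weight_cat i s1 j s2 :
  walk_weight i (s1 ++ j :: s2) =
  walk_weight i (rcons s1 j) + walk_weight j s2.
Proof.
elim: s1 i => [|k s1 IHs] i /=; first by rewrite adde0.
by rewrite IHs addeA.
Qed.

Lemma walk_weight_zip i s j :
  walk_weight i (rcons s j) =
  \sum_(a <- zip (i :: s) (rcons s j)) (B a.1 a.2 - lambda%:E).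
Proof.
elim: s i => [|k s IHs] i /=; first by rewrite big_seq1 adde0.
by rewrite big_cons IHs.
Qed.

Lemma walk_weight_circuit i s :
  walk_weight i (rcons s i) =
  weight B (i :: s) - (lambda * (size (i :: s))%:R)%:E.
Proof.
rewrite walk_weight_zip /weight /circuit_arcs rot1_cons.
have -> : size (i :: s) = size (zip (i :: s) (rcons s i)).
  by rewrite size_zip size_rcons minnn.
elim: (zip _ _) => [|a t IHt]; first by rewrite !big_nil /= mulr0 sube0.
rewrite !big_cons IHt /= addeACA -EFinD -natr1; congr (_ + _%:E); ring.
Qed.

Lemma walk_weight_ninfty i s :
  i \in L -> {subset s <= L} -> walk_weight i s != -oo.
Proof.
elim: s i => [|j s IHs] i iL sL //=.
have jL : j \in L by apply: sL; rewrite mem_head.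
rewrite !adde_eq_ninfty !negb_or IHs // ?B_ninfty //= => k ks.
by apply: sL; rewrite inE ks orbT.
Qed.

Hypothesis simple_ge : forall c, c != [::] -> uniq c -> {subset c <= L} ->
  (lambda * (size c)%:R)%:E <= weight B c.

Let simple i s := uniq (i :: s) && all (mem L) s.

Let dist i := \big[mine/+oo]_(s : n.-bseq 'I_n | simple i s) walk_weight i s.

Let dist_le i s : simple i s -> dist i <= walk_weight i s.
Proof.
move=> sis; have size_s : (size s <= n)%N.
  case/andP: sis => /card_uniqP /= card_is _.
  by rewrite ltnW // -card_is -[X in (_ <= X)%N](card_ord n) max_card.
by apply: (@bigmin_le_cond _ _ _ _ (Bseq size_s)).
Qed.

Let dist_ninfty i : i \in L -> dist i != -oo.
Proof.
rewrite /dist => iL.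
case: (@bigmine_attained R (n.-bseq 'I_n) (fun s : n.-bseq 'I_n => simple i s)
  (fun s : n.-bseq 'I_n => walk_weight i s)) => [-> //|[s /andP[_ /allP sL] ->]].
exact: walk_weight_ninfty.
Qed.

Let dist_fin i : i \in L -> dist i \is a fin_num.
Proof.
move=> iL; rewrite fin_numE dist_ninfty //=.
have : dist i <= walk_weight i [::] by apply: dist_le.
by apply: contraTneq => ->.
Qed.

Let dist_step i j : i \in L -> j \in L -> dist i <= B i j - lambda%:E + dist j.
Proof.
move=> iL jL; rewrite /dist.
case: (@bigmine_attained R (n.-bseq 'I_n) (fun s : n.-bseq 'I_n => simple j s)
  (fun s : n.-bseq 'I_n => walk_weight j s)) => [->|[s sjs ->]].
  by rewrite addey ?leey // adde_eq_ninfty negb_or B_ninfty.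
rewrite -/(walk_weight i (j :: s)); move: sjs; rewrite /simple => sjs.
have [|ijs] := boolP (i \in j :: s); last first.
  apply: dist_le; rewrite /simple cons_uniq ijs /= jL /=.
  by move: sjs => /= /andP[-> ->].
move=> i_js; have [s1 [s2 def_js]] : exists s1 s2, j :: s = s1 ++ i :: s2.
  by case/splitPr: i_js => s1 s2; exists s1, s2.
have /andP[js_uniq sL] := sjs; rewrite def_js walk_weight_cat.
have allL : {subset s1 ++ i :: s2 <= L}.
  by rewrite -def_js => k; rewrite inE => /predU1P[->|/(allP sL)].
move: js_uniq; rewrite def_js cat_uniq => /and3P[s1_uniq i_s1 is2_uniq].
have circ_ge0 : 0 <= walk_weight i (rcons s1 i).
  rewrite walk_weight_circuit sube_ge0 ?fin_numE // simple_ge //=.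
    by rewrite s1_uniq andbT; move: i_s1 => /=; rewrite negb_or => /andP[].
  by move=> k; rewrite inE => /predU1P[->//|ks1]; apply: allL; rewrite mem_cat ks1.
apply: le_trans (leeDr _ circ_ge0); apply: dist_le.
rewrite /simple is2_uniq; apply/allP => k ks2; apply: allL.
by rewrite mem_cat inE ks2 !orbT.
Qed.

(** The potential is minus the distance dist i, the least reduced weight of a
    simple walk starting at i.  For an arc (i, j), prefixing an optimal simple
    walk from j with i either yields a simple walk from i, or closes a simple
    circuit through i, which has nonnegative reduced weight and can be dropped.
    So only simple circuits have to be tested, although the conclusion bounds
    all circuits. *)
Lemma potential_exists : exists u, potential L B (fun=> lambda) u.
Proof.
exists (fun i => - fine (dist i))%R => i j iL jL.
have := dist_step iL jL; rewrite -(fineK (dist_fin iL)) -(fineK (dist_fin jL)).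
have := B_ninfty iL jL.
case: (B i j) => [b| |] //= _; rewrite ?leey // !lee_fin; lra.
Qed.

End Existence.
End Potentials.

(** * Minimal circuit mean and critical nodes *)

Section Spectral.
Variables (R : realType) (n : nat).
Implicit Types (B M : 'M[\bar R]_n) (L C : {set 'I_n}) (d u v : 'I_n -> R).
Implicit Types (c s : seq 'I_n) (lambda : R).

Lemma size_gt0 c : c != [::] -> (0 < (size c)%:R :> R)%R.
Proof. by rewrite ltr0n lt0n size_eq0. Qed.

Lemma sum_const c lambda : (\sum_(i <- c) lambda = lambda * (size c)%:R)%R.
Proof. by rewrite big_const_seq count_predT iter_addr_0 mulr_natr. Qed.

Lemma mean_weight_ge B lambda c : c != [::] ->
  (lambda%:E <= mean_weight B c) = ((lambda * (size c)%:R)%:E <= weight B c).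
Proof. by move=> c0; rewrite lee_pdivlMr ?size_gt0. Qed.

Lemma mean_weight_le B lambda c : c != [::] ->
  (mean_weight B c <= lambda%:E) = (weight B c <= (lambda * (size c)%:R)%:E).
Proof. by move=> c0; rewrite lee_pdivrMr ?size_gt0. Qed.

Lemma mean_weight_eq B lambda c : c != [::] ->
  (mean_weight B c == lambda%:E) = (weight B c == (lambda * (size c)%:R)%:E).
Proof. by move=> c0; rewrite !eq_le mean_weight_ge ?mean_weight_le. Qed.

(** The invariant of the stages.  Nonempty walks are required even from a node
    to itself, so that a single remaining node still carries a loop and the
    minimal mean stays finite. *)
Definition well_posed L B :=
  {in L &, forall i j, B i j != -oo} /\
  {in L &, forall i j, tclosure (arcs (mp_graph L B)) i j}.

Lemma cycle_subset L B c : cycle (arcs (mp_graph L B)) c -> {subset c <= L}.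
Proof. by move=> cc i ic; have /and3P[] := next_cycle cc ic. Qed.

Lemma sat_cycle_subset L B d v c :
  cycle (saturated L B d v) c -> {subset c <= L}.
Proof. by move=> cc i ic; have /and3P[] := next_cycle cc ic. Qed.

Lemma saturated_arc L B d v i j :
  saturated L B d v i j -> arcs (mp_graph L B) i j.
Proof. by case/and3P=> /= -> -> /eqP ->. Qed.

Lemma sat_circuit L B d v c :
  c != [::] -> cycle (saturated L B d v) c -> circuit (mp_graph L B) c.
Proof.
move=> c0 cc; apply/and3P; split=> //.
  by apply/allP => i; apply: sat_cycle_subset cc _.
by apply: sub_cycle cc => i j; apply: saturated_arc.
Qed.

Lemma circuit_weight_fin L B c : well_posed L B ->
  circuit (mp_graph L B) c -> weight B c \is a fin_num.
Proof.
case=> Bn _ /and3P[_ _]; rewrite cycle_arcsE => /allP cc.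
rewrite /weight; apply/sum_fin_numP => a /cc /and3P[a1 a2 Ba] _.
by rewrite fin_numE Bn.
Qed.

Let simple_circuit L c := [&& c != [::], uniq c & all (mem L) c].

Let min_mean L B :=
  \big[mine/+oo]_(c : n.-bseq 'I_n | simple_circuit L c) mean_weight B c.

Lemma min_mean_le L B c : c != [::] -> uniq c -> {subset c <= L} ->
  min_mean L B <= mean_weight B c.
Proof.
move=> c0 c_uniq cL; have size_c : (size c <= n)%N.
  by rewrite -(card_uniqP c_uniq) -[X in (_ <= X)%N](card_ord n) max_card.
apply: (@bigmin_le_cond _ _ _ _ (Bseq size_c)).
by rewrite /simple_circuit /= c0 c_uniq; apply/allP.
Qed.

(** The least mean over the finitely many simple circuits admits a potential,
    which then bounds the mean of every circuit from below; hence it is the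
    infimum and it is attained.  Were it infinite, potentials would exist for
    arbitrarily large lambda, contradicting the finite weight of some circuit. *)
Lemma rho_min_attained L B : well_posed L B -> L != finset.set0 ->
  [/\ rho_min L B \is a fin_num,
      exists u, potential L B (fun=> fine (rho_min L B)) u
    & exists c, critical_circuit L B c].
Proof.
move=> wp /set0Pn[i0 i0L]; have [Bn Bc] := wp.
have potE lambda : lambda%:E <= min_mean L B ->
    exists u, potential L B (fun=> lambda) u.
  move=> le_lambda; apply: potential_exists => // c c0 c_uniq cL.
  by rewrite -mean_weight_ge // (le_trans le_lambda) // min_mean_le.
have rho_ge lambda u : potential L B (fun=> lambda) u ->
    lambda%:E <= rho_min L B.
  move=> pot; apply: le_ereal_inf_tmp => _ [c /and3P[c0 /allP cL _] <-].
  by rewrite mean_weight_ge // -sum_const; apply: (weight_ge pot).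
have [c0 c0_circ] : exists c, circuit (mp_graph L B) c.
  have /tclosure_cycle[c cc ic] := Bc i0 i0 i0L i0L.
  exists c; apply/and3P; split=> //; first by case: c ic {cc}.
  by apply/allP => i; apply: cycle_subset cc _.
have min_fin : min_mean L B \is a fin_num.
  rewrite fin_numE; apply/andP; split.
    rewrite /min_mean.
    case: (@bigmine_attained R (n.-bseq 'I_n) (simple_circuit L)
      (fun c : n.-bseq 'I_n => mean_weight B c)) => [-> //|[c]].
    case/and3P=> cn0 _ /allP cL ->.
    have : weight B c != -oo.
      apply/eqP => /esum_eqNyP [a [ac _ Ba]].
      have /andP[a1 a2] := circuit_arcs_mem ac.
      by have := Bn _ _ (cL _ a1) (cL _ a2); rewrite Ba.
    rewrite /mean_weight; case: (weight B c) => // _.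
    by rewrite gt0_mulye // lte_fin invr_gt0 size_gt0.
  apply/negP => /eqP min_oo.
  have := circuit_weight_fin wp c0_circ.
  have /and3P[c0n /allP c0L _] := c0_circ.
  case w : (weight B c0) => [r| |] // _.
  (* Any lambda above the mean r / size c0 of the circuit c0 will do. *)
  have [|u /weight_ge] := potE ((r + 1) / (size c0)%:R)%R.
    by rewrite min_oo leey.
  move/(_ _ c0L); rewrite sum_const w lee_fin divfK ?gt_eqF ?size_gt0 //; lra.
have [|u pot] := potE (fine (min_mean L B)); first by rewrite fineK.
have [c [c0n c_uniq cL] mean_c] : exists2 c,
    [/\ c != [::], uniq c & {subset c <= L}] & mean_weight B c = min_mean L B.
  move: min_fin; rewrite /min_mean.
  case: (@bigmine_attained R (n.-bseq 'I_n) (simple_circuit L)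
    (fun c : n.-bseq 'I_n => mean_weight B c)) => [-> //|[c]].
  by case/and3P=> cn0 c_uniq /allP cL -> _; exists (bseqval c).
have c_circ : circuit (mp_graph L B) c.
  apply: (@sat_circuit _ _ (fun=> fine (min_mean L B)) u) => //.
  apply/(weight_tight pot) => //; rewrite sum_const; apply/eqP.
  by rewrite -mean_weight_eq // mean_c fineK.
have rhoE : rho_min L B = min_mean L B.
  apply/eqP; rewrite eq_le -{2}(fineK min_fin) (rho_ge _ u pot) andbT.
  by rewrite -mean_c; apply: ereal_inf_lbound; exists c.
rewrite rhoE; split=> //; first by exists u.
by exists c; split; rewrite // mean_c rhoE.
Qed.

Section CriticalNodes.
Variables (L : {set 'I_n}) (B : 'M[\bar R]_n) (lambda : R).
Hypothesis rhoE : rho_min L B = lambda%:E.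

Lemma critical_node_circuit i : i \in critical_nodes L B ->
  exists c, [/\ i \in c, {subset c <= critical_nodes L B}
              & weight B c = (\sum_(j <- c) lambda)%:E].
Proof.
rewrite inE => /asboolP[c cc ic]; exists c; split=> //.
  by move=> j jc; rewrite inE; apply/asboolP; exists c.
case: cc => /and3P[c0 _ _]; rewrite rhoE => /eqP.
by rewrite mean_weight_eq // sum_const => /eqP.
Qed.

Lemma critical_nodes_sub : critical_nodes L B \subset L.
Proof.
apply/fintype.subsetP => i; rewrite inE => /asboolP[c [/and3P[_ /allP cL _] _]].
exact: cL.
Qed.

(** A closed saturated walk has mean lambda, whatever the potential used to
    certify it. *)
Lemma critical_node_closed_walk u i : potential L B (fun=> lambda) u ->
  tclosure (saturated L B (fun=> lambda) u) i i -> i \in critical_nodes L B.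
Proof.
move=> pot /tclosure_cycle[c cc ic]; rewrite inE; apply/asboolP; exists c => //.
have c0 : c != [::] by case: c ic {cc}.
split; first exact: sat_circuit cc.
rewrite rhoE; apply/eqP; rewrite mean_weight_eq // -sum_const; apply/eqP.
by apply/(weight_tight pot) => //; apply: sat_cycle_subset cc.
Qed.

End CriticalNodes.

End Spectral.

(** * Schur complements and saturated walks *)

Section Schur.
Variables (R : realType) (n : nat).
Variables (L C : {set 'I_n}) (B : 'M[\bar R]_n) (lambda : R).
Hypothesis CL : {subset C <= L}.
Implicit Types (d u v : 'I_n -> R) (i j k m : 'I_n).

Let M := mp_unscale lambda B.
Let W p := iter p (mp_mul C M) (@mp_one R n).
Let S := mp_schur C lambda B.

(** Least reduced weight of a walk from k to j whose intermediate nodes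
    all lie in C. *)
Definition exit_weight k j : \bar R :=
  \big[mine/+oo]_(m in C) (mp_star C M k m + M m j).

Let ME i j : M i j = B i j - lambda%:E. Proof. by rewrite mxE. Qed.

Let W0E i j : W 0 i j = if i == j then 0 else +oo. Proof. by rewrite mxE. Qed.

Let WSE p i j : W p.+1 i j = \big[mine/+oo]_(k in C) (M i k + W p k j).
Proof. by rewrite /W iterS mxE. Qed.

Let star_le p i j : mp_star C M i j <= W p i j.
Proof. by rewrite mxE; apply: ereal_inf_lbound; exists p. Qed.

Let SE i j : S i j = mine (B i j)
  (\big[mine/+oo]_(m in C) (\big[mine/+oo]_(k in C) (B i k + mp_star C M k m)
     + M m j)).
Proof.
by rewrite mxE; congr mine; rewrite mxE; apply: eq_bigr => m _; rewrite mxE.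
Qed.

Lemma schur_le i j : mp_schur C lambda B i j <= B i j.
Proof. by rewrite -/S SE ge_min lexx. Qed.

Lemma schur_le_exit i k j r : k \in C -> B i k = r%:E ->
  mp_schur C lambda B i j <= r%:E + exit_weight k j.
Proof.
move=> kC Bik; rewrite -/S SE ge_min; apply/orP; right; rewrite /exit_weight.
case: (bigmine_attained (mem C) (fun m => mp_star C M k m + M m j)) => [->|].
  by rewrite addey ?leey.
move=> [m mC ->]; rewrite addeA; apply: (@bigmin_inf _ _ _ _ m) => //.
by apply: leeD2r; rewrite -Bik; apply: bigmin_le_cond.
Qed.

Lemma exit_weight_le k j : k \in C -> exit_weight k j <= B k j - lambda%:E.
Proof.
move=> kC; apply: (@bigmin_inf _ _ _ _ k) => //.
rewrite ME -[leRHS]add0e; apply: leeD2r.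
by apply: le_trans (star_le 0 k k) _; rewrite W0E eqxx.
Qed.

Lemma exit_weight_step k m j r : k \in C -> m \in C -> B k m = r%:E ->
  exit_weight k j <= (r - lambda)%:E + exit_weight m j.
Proof.
move=> kC mC Bkm; have Mkm : M k m = (r - lambda)%:E by rewrite ME Bkm.
rewrite /exit_weight.
case: (bigmine_attained (mem C) (fun m' => mp_star C M m m' + M m' j)) => [->|].
  by rewrite addey ?leey.
move=> [m' mC' ->]; rewrite addeA; apply: (@bigmin_inf _ _ _ _ m') => //.
apply: leeD2r; rewrite -leeBlDl // [in leRHS]mxE.
apply: le_ereal_inf_tmp => _ [p _ <-]; rewrite leeBlDl //.
apply: le_trans (star_le p.+1 k m') _.
by rewrite WSE -Mkm; apply: bigmin_le_cond.
Qed.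

Section LowerBound.
Variables (d v : 'I_n -> R) (delta : R).
Hypothesis d_eq : {in C, forall k, d k = lambda}.
Let e := saturated L B d v.
Hypothesis delta_ge0 : (0 <= delta)%R.
Hypothesis gap : {in L &, forall i j,
  (d i + v j - v i + delta * (~~ e i j)%:R)%:E <= B i j}.

Let lee_gapD (a b c : bool) (r1 r2 r : R) (x y : \bar R) :
  (r1 + delta * (~~ a)%:R)%:E <= x -> (r2 + delta * (~~ b)%:R)%:E <= y ->
  (a -> b -> c) -> (r1 + r2 = r)%R -> (r + delta * (~~ c)%:R)%:E <= x + y.
Proof.
move=> ax byy abc <-; apply: le_trans (leeD ax byy); rewrite -EFinD lee_fin.
have := delta_ge0; move: a b c abc {ax byy} => [] [] [] abc;
  rewrite /= !(mulr0n, mulr1n, mulr0, mulr1); try lra.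
Qed.

Let M_gap k j : k \in C -> j \in L ->
  (v j - v k + delta * (~~ e k j)%:R)%:E <= M k j.
Proof.
move=> kC jL; rewrite ME leeBrDr // -EFinD.
by apply: le_trans (gap (CL kC) jL); rewrite lee_fin d_eq //; lra.
Qed.

Let W_gap p k m : k \in C -> m \in C ->
  (v m - v k + delta * (~~ connect e k m)%:R)%:E <= W p k m.
Proof.
elim: p k m => [|p IHp] k m kC mC.
  rewrite W0E; case: eqP => [->|_]; last exact: leey.
  by rewrite connect0 mulr0 addr0 subrr.
rewrite WSE; apply: le_bigmin => [|j jC]; first exact: leey.
apply: lee_gapD (M_gap kC (CL jC)) (IHp _ _ jC mC) _ _; last lra.
by move=> /connect1; apply: connect_trans.
Qed.

Let star_gap k m : k \in C -> m \in C ->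
  (v m - v k + delta * (~~ connect e k m)%:R)%:E <= mp_star C M k m.
Proof.
by move=> kC mC; rewrite mxE; apply: le_ereal_inf_tmp => _ [p _ <-]; apply: W_gap.
Qed.

Lemma exit_weight_gap k j : k \in C -> j \in L ->
  (v j - v k + delta * (~~ tclosure e k j)%:R)%:E <= exit_weight k j.
Proof.
move=> kC jL; apply: le_bigmin => [|m mC]; first exact: leey.
apply: lee_gapD (star_gap kC mC) (M_gap mC jL) _ _; last lra.
move=> km mj; case/connectP: km => [[|z p] /= zp zm].
  by apply: tclosure1; rewrite -zm in mj *.
case/andP: zp => kz zp; apply/existsP; exists z; rewrite kz.
by apply: (connect_trans _ (connect1 mj)); apply/connectP; exists p.
Qed.

(** Quantitative form of the correspondence between arcs of the Schur
    complement and walks of B: an arc that does not unfold into saturated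
    arcs pays at least delta, since some arc of each of the walks it
    summarizes does.  Stating it with the uniform margin delta lets it pass
    through the infimum over all powers in the star. *)
Lemma schur_gap i j : i \in L -> j \in L ->
  (d i + v j - v i + delta * (~~ tclosure e i j)%:R)%:E <= mp_schur C lambda B i j.
Proof.
move=> iL jL; rewrite -/S SE le_min; apply/andP; split.
  rewrite -[B i j]adde0; apply: (lee_gapD (gap iL jL) (_ : (0 + delta * (~~ true)%:R)%:E <= 0)).
  - by rewrite mulr0 addr0.
  - by move=> /tclosure1.
  - by rewrite addr0.
apply: le_bigmin => [|m mC]; first exact: leey.
have step : (d i + v m - v i + delta * (~~ tclosure e i m)%:R)%:E <=
    \big[mine/+oo]_(k in C) (B i k + mp_star C M k m).
  apply: le_bigmin => [|k kC]; first exact: leey.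
  apply: lee_gapD (gap iL (CL kC)) (star_gap kC mC) _ _; last lra.
  by move=> /tclosure1; apply: tclosure_trans_r.
apply: lee_gapD step (M_gap mC jL) _ _; last lra.
by move=> im /connect1; apply: tclosure_trans_r im.
Qed.

End LowerBound.

Section Potential.
Variables d v : 'I_n -> R.
Hypothesis d_eq : {in C, forall k, d k = lambda}.
Hypothesis pot : potential L B d v.

Let exists_gap : exists2 delta, (0 < delta)%R & {in L &, forall i j,
  (d i + v j - v i + delta * (~~ saturated L B d v i j)%:R)%:E <= B i j}.
Proof.
have [delta delta0 gap] := finite_gap
  (fun a : 'I_n * 'I_n => fine (B a.1 a.2) - (d a.1 + v a.2 - v a.1))%R.
exists delta => // i j iL jL; have := pot iL jL; rewrite /saturated iL jL /=.
have := gap (i, j); rewrite /=.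
case: (B i j) => [r| |] /= gapij le_ij; last 2 first; [exact: leey | by [] | ].
rewrite eqe !lee_fin; case: eqP => [->|/eqP ne]; rewrite ?mulr0 ?addr0 // mulr1.
move: le_ij gapij; rewrite lee_fin => le_r; rewrite subr_gt0.
by rewrite lt_neqAle eq_sym ne le_r => /(_ isT); lra.
Qed.

Lemma schur_potential : potential L (mp_schur C lambda B) d v.
Proof.
have [delta delta0 gap] := exists_gap => i j iL jL.
apply: le_trans (schur_gap d_eq (ltW delta0) gap iL jL); rewrite lee_fin lerDl.
by rewrite mulr_ge0 ?ler0n ?ltW.
Qed.

(** Only L containing C and both end nodes matters, so applying this to a
    smaller L confines the unfolded walk to that set. *)
Lemma schur_saturated i j : i \in L -> j \in L ->
  mp_schur C lambda B i j = (d i + v j - v i)%:E ->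
  tclosure (saturated L B d v) i j.
Proof.
have [delta delta0 gap] := exists_gap => iL jL Sij.
have := schur_gap d_eq (ltW delta0) gap iL jL; rewrite Sij lee_fin.
by case: (tclosure _ i j) => //; rewrite /= mulr1; lra.
Qed.

Lemma exit_weight_ge k j : k \in C -> j \in L ->
  (v j - v k)%:E <= exit_weight k j.
Proof.
have [delta delta0 gap] := exists_gap => kC jL.
apply: le_trans (exit_weight_gap d_eq (ltW delta0) gap kC jL).
by rewrite lee_fin lerDl mulr_ge0 ?ler0n ?ltW.
Qed.

End Potential.
End Schur.

(** * Eliminating the critical nodes *)

Section Elimination.
Variables (R : realType) (n : nat).
Variables (L C : {set 'I_n}) (B : 'M[\bar R]_n) (lambda : R) (u : 'I_n -> R).
Hypothesis CL : {subset C <= L}.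
Hypothesis pot_u : potential L B (fun=> lambda) u.

Let N := L :\: C.
Let B' := mp_schur C lambda B.
Let T := exit_weight C B lambda.

Let N_sub : {subset N <= L}. Proof. by move=> i /setDP[]. Qed.

Let splitL i : i \in L -> (i \in N) || (i \in C).
Proof. by rewrite !inE => ->; case: (i \in C). Qed.

Let T_ninfty k j : k \in C -> j \in L -> T k j != -oo.
Proof.
move=> kC jL; have := exit_weight_ge CL (d := fun=> lambda) (fun _ _ => erefl) pot_u kC jL.
by apply: contraTneq; rewrite -/T => ->.
Qed.

(** A walk of B between two remaining nodes is cut at its visits to N; each
    excursion through C has finite exit weight, hence is an arc of the Schur
    complement. *)
Lemma schur_well_posed : well_posed L B -> well_posed N B'.
Proof.
move=> [Bn Bc]; have B'n : {in N &, forall i j, B' i j != -oo}.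
  move=> i j /N_sub iL /N_sub jL.
  have := schur_potential CL (d := fun=> lambda) (fun _ _ => erefl) pot_u iL jL.
  by rewrite -/B'; apply: contraTneq => ->.
split=> //.
have fin_arc i j : arcs (mp_graph L B) i j -> exists r, B i j = r%:E.
  case/and3P=> iL jL; have := Bn _ _ iL jL.
  by case: (B i j) => [r| |] //; exists r.
have le_fin (x y : \bar R) : x <= y -> y != +oo -> x != +oo.
  by move=> xy; apply: contra => /eqP x_oo; rewrite x_oo leye_eq in xy.
have arcNN i j : i \in N -> j \in N -> arcs (mp_graph L B) i j ->
    arcs (mp_graph N B') i j.
  move=> iN jN /and3P[_ _ Bij]; rewrite /= iN jN.
  exact: le_fin (schur_le _ _ _ _ _) Bij.
have arcNC i k j : i \in N -> k \in C -> j \in N -> arcs (mp_graph L B) i k ->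
    T k j != +oo -> arcs (mp_graph N B') i j.
  move=> iN kC jN /fin_arc[r Bik] Tkj; rewrite /= iN jN.
  apply: le_fin (schur_le_exit _ _ kC Bik) _; move: Tkj; rewrite -/T.
  by case: (T k j).
have walk j p i : j \in N -> path (arcs (mp_graph L B)) i p -> last i p = j ->
    (i \in N -> connect (arcs (mp_graph N B')) i j) /\
    (i \in C -> exists m, [/\ m \in N, T i m != +oo
                             & connect (arcs (mp_graph N B')) m j]).
  move=> jN; elim: p i => [|k p IHp] i /=.
    move=> _ ->; split=> [_|jC]; first exact: connect0.
    by move: jN; rewrite inE jC.
  case/andP=> ik kp /(IHp _ kp)[kN_conn kC_conn].
  have /and3P[_ kL _] := ik; have /orP[kN|kC] := splitL kL; split.
  - by move=> iN; apply: connect_trans (connect1 (arcNN _ _ iN kN ik)) (kN_conn kN).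
  - move=> iC; exists k; split=> //; last exact: kN_conn.
    have [r Bik] := fin_arc _ _ ik.
    have := exit_weight_le B lambda k iC; rewrite Bik => T_le.
    exact: le_fin T_le _.
  - move=> iN; have [m [mN Tkm mj]] := kC_conn kC.
    by apply: connect_trans (connect1 (arcNC _ _ _ iN kC mN ik Tkm)) mj.
  - move=> iC; have [m [mN Tkm mj]] := kC_conn kC; exists m; split=> //.
    have [r Bik] := fin_arc _ _ ik.
    have := exit_weight_step lambda m iC kC Bik => T_le.
    by apply: le_fin T_le _; move: Tkm; rewrite -/T; case: (T k m).
move=> i j iN jN; have /existsP[k /andP[ik]] := Bc _ _ (N_sub iN) (N_sub jN).
case/connectP=> p kp /esym lastp; have [kN_conn kC_conn] := walk _ _ _ jN kp lastp.
have /and3P[_ kL _] := ik; have /orP[kN|kC] := splitL kL; apply/existsP.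
  by exists k; rewrite kN_conn // andbT; apply: arcNN.
have [m [mN Tkm mj]] := kC_conn kC.
by exists m; rewrite mj andbT; apply: arcNC ik Tkm.
Qed.

(** On an eliminated node k, the constraints from arcs leaving k are lower
    bounds for w k, the tightest being the largest v j minus the exit weight
    from k to j; the arcs entering k impose upper bounds, which follow from
    the potential inequality of the Schur complement.  If N cannot be reached
    from k there is no lower bound coming from N: the value u k - K is then
    used.  These values are compatible with each other since u is a potential
    for lambda, and with the upper bounds when K is large. *)
Lemma potential_extend d v : {in L &, forall i j, B i j != -oo} ->
  {in C, forall k, d k = lambda} -> potential N B' d v ->
  exists2 w, {in N, w =1 v} & potential L B d w.
Proof.
move=> Bn d_eq pot_v.
have [K K_ub] := finite_ub
  (fun a : 'I_n * 'I_n => u a.2 - v a.1 - fine (B a.1 a.2) + d a.1)%R.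
(* The default u k - K of the maximum keeps z k real and provides the value
   used when no node of N is reachable from k. *)
pose z k := (\big[Order.max/u k - K]_(j in N | T k j != +oo) (v j - fine (T k j)))%R.
pose w i := if i \in C then z i else v i.
have wN : {in N, w =1 v} by move=> i /setDP[_ iC]; rewrite /w (negPf iC).
have wC k : k \in C -> w k = z k by rewrite /w => ->.
have T_fin k j : k \in C -> j \in L -> T k j != +oo -> T k j = (fine (T k j))%:E.
  by move=> kC jL Tkj; rewrite fineK // fin_numE T_ninfty.
exists w => // i j iL jL; have := Bn _ _ iL jL.
case Bij : (B i j) => [r| |] // _; last exact: leey.
rewrite lee_fin.
have /orP[iN|iC] := splitL iL; have /orP[jN|jC] := splitL jL.
- rewrite !wN // -lee_fin -Bij; apply: le_trans (pot_v _ _ iN jN) _.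
  exact: schur_le.
- rewrite (wN _ iN) (wC _ jC) -lerBrDr -lerBrDl.
  apply: bigmax_le => [|m /andP[mN Tjm]].
    by have := K_ub (i, j); rewrite /= Bij /=; lra.
  have := le_trans (pot_v _ _ iN mN) (schur_le_exit _ _ jC Bij).
  by rewrite -/T (T_fin _ _ jC (N_sub mN) Tjm) -EFinD lee_fin; lra.
- rewrite (wN _ jN) (wC _ iC) d_eq //.
  have := exit_weight_le B lambda j iC; rewrite Bij -/T => T_le.
  have Tij : T i j != +oo by apply: contraTneq T_le => ->.
  have : (v j - fine (T i j) <= z i)%R.
    by apply: (@le_bigmax_cond _ _ _ _ j); rewrite jN.
  by move: T_le; rewrite (T_fin _ _ iC jL Tij) -EFinB lee_fin; lra.
- rewrite !wC // d_eq // -lerBrDr -lerBrDl.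
  apply: bigmax_le => [|m /andP[mN Tjm]].
    have : (u i - K <= z i)%R by apply: bigmax_ge_id.
    by have := pot_u iL jL; rewrite Bij lee_fin; lra.
  have := exit_weight_step lambda m iC jC Bij; rewrite -/T.
  rewrite (T_fin _ _ jC (N_sub mN) Tjm) -EFinD => T_le.
  have Tim : T i m != +oo by apply: contraTneq T_le => ->.
  have : (v m - fine (T i m) <= z i)%R.
    by apply: (@le_bigmax_cond _ _ _ _ m); rewrite mN.
  by move: T_le; rewrite (T_fin _ _ iC (N_sub mN) Tim) lee_fin; lra.
Qed.

End Elimination.

Section OneStep.
Variables (R : realType) (n : nat) (L : {set 'I_n}) (B : 'M[\bar R]_n).
Hypothesis wp : well_posed L B.

Let C := critical_nodes L B.
Let lambda := fine (rho_min L B).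
Let N := L :\: C.
Let B' := mp_schur C lambda B.

Let CL : {subset C <= L}.
Proof. exact/fintype.subsetP/critical_nodes_sub. Qed.

Lemma critical_nodes_neq0 : L != finset.set0 -> C != finset.set0.
Proof.
move=> L0; have [_ _ [c cc]] := rho_min_attained wp L0.
have /and3P[c0 _ _] := cc.1; case: c c0 cc => [|i c] // _ cc.
by apply/set0Pn; exists i; rewrite inE; apply/asboolP; exists (i :: c);
  rewrite ?mem_head.
Qed.

Lemma stage_well_posed : well_posed N B'.
Proof.
have [L0|L0] := eqVneq L finset.set0.
  by split=> i j; rewrite /N L0 !inE andbF.
have [_ [u pot_u] _] := rho_min_attained wp L0.
exact: schur_well_posed pot_u wp.
Qed.

(** A circuit of mean lambda in the Schur complement would unfold into a closed
    saturated walk of B through remaining nodes, which would be critical. *)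
Lemma rho_min_schur_gt : L != finset.set0 -> N != finset.set0 ->
  (lambda < fine (rho_min N B'))%R.
Proof.
move=> L0 N0; have [rho_fin [u pot_u] _] := rho_min_attained wp L0.
have [rho'_fin _ [c [c_circ c_mean]]] := rho_min_attained stage_well_posed N0.
have /and3P[c0 /allP cN _] := c_circ.
have pot' : potential N B' (fun=> lambda) u.
  apply: potentialS (subsetDl L C) _.
  exact: schur_potential.
rewrite -lte_fin (fineK rho'_fin) -c_mean lt_neqAle mean_weight_ge // -sum_const.
rewrite (weight_ge pot' cN) andbT eq_sym mean_weight_eq // -sum_const.
apply/eqP => /(weight_tight pot' cN) cc.
have [i ic] : exists i, i \in c by case: (c) c0 => // i s; exists i; rewrite mem_head.
have /setDP[iL /negP] := cN i ic; apply.
apply: (@critical_node_closed_walk _ _ _ _ lambda _ _ _ pot_u).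
  by rewrite /lambda fineK.
apply: tclosure_sub (cycle_tclosure cc ic) => j k /and3P[].
move=> /setDP[jL _] /setDP[kL _] /eqP.
exact: (schur_saturated CL (d := fun=> lambda)).
Qed.

End OneStep.

(** * The sequence of stages and the certificate *)

(** Counting the indices at which a decreasing predicate holds finds its last
    true index. *)
Lemma count_antitone (p : pred nat) (n l : nat) :
  (forall i, (0 < i)%N -> p i.+1 -> p i) -> (0 < l <= n)%N ->
  p l = (l <= count p (iota 1 n))%N.
Proof.
move=> p_anti /andP[l0 ln].
have p_le i j : (0 < i)%N -> (i <= j)%N -> p j -> p i.
  move=> i0; elim: j => [|j IHj]; first by rewrite leqn0 => /eqP ->.
  rewrite leq_eqVlt => /predU1P[-> //|ij] pj; apply: IHj; first by lia.
  by apply: p_anti pj; lia.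
elim: n ln => [|n IHn] ln; first by move: l0; rewrite ltnNge ln.
have -> : iota 1 n.+1 = rcons (iota 1 n) n.+1.
  by rewrite -cats1 -[in LHS](addn1 n) iotaD add1n.
rewrite -cats1 count_cat /= addn0.
case pn : (p n.+1).
  rewrite (p_le _ _ l0 ln pn).
  suff -> : count p (iota 1 n) = n by rewrite addn1 ln.
  apply/eqP; rewrite -[X in _ == X](size_iota 1 n) -all_count.
  apply/allP => i; rewrite mem_iota => /andP[i0 i_n].
  by apply: p_le pn => //; lia.
move: ln; rewrite leq_eqVlt addn0 => /predU1P[->|]; last exact: IHn.
rewrite pn; apply/esym/negbTE; rewrite -ltnNge ltnS.
by rewrite (leq_trans (count_size _ _)) // size_iota.
Qed.

Section Stages.
Variables (R : realType) (n : nat) (A : 'M[\bar R]_n).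
Hypothesis hA : forall i j, A i j != -oo.
Hypothesis hirr : mp_irreducible A.
Hypothesis hn1 : ~ (n = 1%N /\ A = const_mx +oo).

Let k := ncrit A.

(** The sets N^l decrease with l, so the number of those containing x is the
    index l with x in C_l. *)
Definition level (x : 'I_n) : nat :=
  count (fun l => x \in Nrem A l) (iota 1 (ncrit A)).

Definition level_value (x : 'I_n) : R := alpha A (level x).

Lemma CcumS l : Ccum A l.+1 = Ccum A l :|: Ccrit A l.+1.
Proof. by []. Qed.

Lemma NremS l : Nrem A l.+2 = Nrem A l.+1 :\: Ccrit A l.+1.
Proof. by rewrite {1}/Nrem CcumS finset.setCU finset.setDE. Qed.

Lemma AmatS l :
  Amat A l.+2 = mp_schur (Ccrit A l.+1) (alpha A l.+1) (Amat A l.+1).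
Proof. by []. Qed.

Lemma Nrem1 : Nrem A 1 = [set: 'I_n].
Proof. by rewrite /Nrem /= finset.setC0. Qed.

Lemma Ccrit_sub l : Ccrit A l \subset Nrem A l.
Proof. exact: critical_nodes_sub. Qed.

(** Irreducibility gives no arc in the one-node case, where the loop comes from
    the exclusion of the matrix (+oo). *)
Lemma irreducible_well_posed : well_posed [set: 'I_n] A.
Proof.
split=> i j _ _ //.
suff [z iz] : exists z, arcs (mp_graph [set: 'I_n] A) i z.
  by apply/existsP; exists z; rewrite iz; apply: hirr; rewrite inE.
have [ne|] := boolP [exists z, z != i].
  have /existsP[z zi] := ne.
  have : connect (arcs (mp_graph [set: 'I_n] A)) i z by apply: hirr; rewrite inE.
  case/connectP=> [[|w p] /= ip zp]; first by rewrite zp eqxx in zi.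
  by case/andP: ip => iw _; exists w.
rewrite negb_exists => /forallP all_i.
have {}all_i z : z = i by apply/eqP; rewrite -[_ == _]negbK.
have n1 : n = 1%N.
  rewrite -(card_ord n); apply/eqP; rewrite eqn_leq; apply/andP; split.
    by apply/fintype_le1P => x y; rewrite (all_i x) (all_i y).
  by apply/card_gt0P; exists i.
exists i; rewrite /= !inE; apply/eqP => Aii; apply: hn1; split=> //.
by apply/matrixP => x y; rewrite mxE (all_i x) (all_i y).
Qed.

Lemma level_well_posed l : well_posed (Nrem A l.+1) (Amat A l.+1).
Proof.
elim: l => [|l IHl]; first by rewrite Nrem1; apply: irreducible_well_posed.
by rewrite NremS AmatS; apply: stage_well_posed.
Qed.

Lemma Nrem_anti l : Nrem A l.+2 \subset Nrem A l.+1.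
Proof. by rewrite NremS subsetDl. Qed.

Lemma Nrem_subset l m : (0 < l <= m)%N -> Nrem A m \subset Nrem A l.
Proof.
case/andP=> l0; elim: m => [|m IHm]; first by rewrite leqNgt l0.
rewrite leq_eqVlt => /predU1P[-> //|]; case: m IHm => [|m] IHm lm; first by lia.
by apply: fintype.subset_trans (Nrem_anti m) _; apply: IHm.
Qed.

(** Each stage removes at least one node, so n stages suffice. *)
Lemma Nrem_exhausted : Nrem A n.+1 = finset.set0.
Proof.
have card_Nrem l : (#|Nrem A l.+1| <= n - l)%N.
  elim: l => [|l IHl]; first by rewrite subn0 -[X in (_ <= X)%N](card_ord n) max_card.
  have [N0|N0] := eqVneq (Nrem A l.+1) finset.set0.
    by rewrite NremS N0 finset.set0D cards0.
  have C0 := critical_nodes_neq0 (level_well_posed l) N0.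
  rewrite NremS cardsD (finset.setIidPr (Ccrit_sub _)).
  move: C0; rewrite -/(Ccrit A l.+1) -card_gt0; lia.
by apply/eqP; rewrite -cards_eq0 -leqn0 -(subnn n).
Qed.

Lemma Nrem_neq0 l : (0 < l <= n)%N -> (Nrem A l != finset.set0) = (l <= k)%N.
Proof.
apply: (count_antitone (p := fun l => Nrem A l != finset.set0)) => i i0.
apply: contra => /eqP Ni; rewrite -finset.subset0 -Ni.
by case: i i0 {Ni} => // i _; apply: Nrem_anti.
Qed.

Lemma ncrit_le : (k <= n)%N.
Proof. by rewrite (leq_trans (count_size _ _)) // size_iota. Qed.

Lemma Nrem_ncritS : Nrem A k.+1 = finset.set0.
Proof.
have [->|kn] := eqVneq k n; first exact: Nrem_exhausted.
apply/eqP; rewrite -[_ == _]negbK Nrem_neq0; first by rewrite ltnn.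
by rewrite /= ltn_neqAle kn ncrit_le.
Qed.

Lemma level_le x : (level x <= k)%N.
Proof. by rewrite (leq_trans (count_size _ _)) // size_iota. Qed.

Lemma mem_Nrem x l : (0 < l <= k)%N -> (x \in Nrem A l) = (l <= level x)%N.
Proof.
apply: (count_antitone (p := fun l => x \in Nrem A l)) => i i0.
by apply: fintype.subsetP; case: i i0 => // i _; apply: Nrem_anti.
Qed.

Lemma mem_Ccum x l : (l <= k)%N -> (x \in Ccum A l) = (level x <= l)%N.
Proof.
move=> lk; have -> : (x \in Ccum A l) = (x \notin Nrem A l.+1).
  by rewrite /Nrem inE negbK.
have [->|lk'] := eqVneq l k; first by rewrite Nrem_ncritS inE level_le.
by rewrite mem_Nrem -?leqNgt //= ltn_neqAle lk'.
Qed.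

Lemma mem_Ccrit x l : (0 < l <= k)%N -> (x \in Ccrit A l) = (level x == l).
Proof.
case: l => // l /= lk.
have xl1 := mem_Ccum x lk; have xl := mem_Ccum x (ltnW lk).
have C_N := fintype.subsetP (Ccrit_sub l.+1) x.
move: xl1 C_N; rewrite CcumS finset.in_setU [_ \in Nrem _ _]inE /= xl eqn_leq => <-.
by rewrite -ltnNge; case: (x \in Ccrit A l.+1) => [/(_ isT) -> | _];
  rewrite ?orbT // orbF; case: leqP.
Qed.

Lemma level_gt0 x : (0 < level x)%N.
Proof.
have n0 : (0 < n)%N by case: (n) x => // -[].
have k0 : (0 < k)%N.
  by rewrite -Nrem_neq0 // Nrem1; apply/set0Pn; exists x; rewrite inE.
by rewrite -mem_Nrem ?Nrem1 ?inE.
Qed.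

Lemma rho_min_alpha l : (0 < l <= k)%N ->
  rho_min (Nrem A l) (Amat A l) = (alpha A l)%:E.
Proof.
case: l => // l /= lk; have N0 : Nrem A l.+1 != finset.set0.
  by rewrite Nrem_neq0 // (leq_trans lk) // ncrit_le.
by have [rho_fin _ _] := rho_min_attained (level_well_posed l) N0; rewrite fineK.
Qed.

Lemma alphaS_gt l : (0 < l < k)%N -> (alpha A l < alpha A l.+1)%R.
Proof.
case: l => // l /= lk; have kn := ncrit_le.
rewrite {2}/alpha NremS; apply: rho_min_schur_gt; first exact: level_well_posed.
  by rewrite Nrem_neq0 //; lia.
by rewrite -NremS Nrem_neq0 //; lia.
Qed.

Lemma alpha_lt l m : (0 < l)%N -> (l < m <= k)%N -> (alpha A l < alpha A m)%R.
Proof.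
move=> l0 /andP[]; elim: m => // m IHm; rewrite ltnS leq_eqVlt => /predU1P[<-|lm] mk.
  by apply: alphaS_gt; rewrite l0.
by apply: lt_trans (IHm lm (ltnW mk)) _; apply: alphaS_gt; lia.
Qed.

Lemma alpha_le l m : (0 < l)%N -> (l <= m <= k)%N -> (alpha A l <= alpha A m)%R.
Proof.
move=> l0 /andP[]; rewrite leq_eqVlt => /predU1P[-> //|lm] mk.
by apply/ltW/alpha_lt; rewrite // lm.
Qed.

Lemma level_value_Ccrit l : (0 < l <= k)%N ->
  {in Ccrit A l, forall x, level_value x = alpha A l}.
Proof. by move=> lk x; rewrite mem_Ccrit // /level_value => /eqP ->. Qed.

(** Backward induction on the stages: t counts the stages already treated,
    starting from the last one. *)
Lemma level_potential_exists : exists v, forall l, (0 < l <= k)%N ->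
  potential (Nrem A l) (Amat A l) level_value v.
Proof.
suff H t : (t <= k)%N -> exists v, forall l, (k - t < l <= k)%N ->
    potential (Nrem A l) (Amat A l) level_value v.
  by have [v pot_v] := H k (leqnn k); exists v => l lk; apply: pot_v; lia.
elim: t => [|t IHt] tk; first by exists (fun=> 0%R) => l; lia.
have [v pot_v] := IHt (ltnW tk).
have [m km mk] : exists2 m, (k - t = m.+1)%N & (m.+1 <= k)%N.
  by exists (k - t).-1; lia.
have m_bd : (0 < m.+1 <= k)%N by rewrite mk.
have wp := level_well_posed m.
have N0 : Nrem A m.+1 != finset.set0.
  by rewrite Nrem_neq0 // (leq_trans mk) // ncrit_le.
have [_ [u pot_u] _] := rho_min_attained wp N0.
have pot_next : potential (Nrem A m.+1 :\: Ccrit A m.+1)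
    (mp_schur (Ccrit A m.+1) (alpha A m.+1) (Amat A m.+1)) level_value v.
  rewrite -NremS -AmatS; have [->|mk'] := eqVneq m.+1 k.
    by rewrite Nrem_ncritS => i j; rewrite inE.
  by apply: pot_v; rewrite km ltnSn ltn_neqAle mk'.
have [w wv pot_w] := potential_extend (fintype.subsetP (Ccrit_sub _)) pot_u
  wp.1 (level_value_Ccrit m_bd) pot_next.
exists w => l /andP[ml lk]; have {ml} : (m.+1 <= l)%N by lia.
rewrite leq_eqVlt => /predU1P[<- //|ml] i j iN jN.
have /fintype.subsetP Nl : Nrem A l \subset Nrem A m.+2 by apply: Nrem_subset.
rewrite !wv -?NremS; [|exact: Nl | exact: Nl].
by apply: pot_v => //; rewrite km ml.
Qed.

(** Unfolding the arcs of one stage after the other never leaves a set D that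
    contains all the eliminated nodes. *)
Lemma saturated_descent v (D : {set 'I_n}) l :
    (forall m, (0 < m <= k)%N -> potential (Nrem A m) (Amat A m) level_value v) ->
    (l < k)%N -> Ccum A l \subset D ->
  forall i j,
    tclosure (saturated (Nrem A l.+1 :&: D) (Amat A l.+1) level_value v) i j ->
    tclosure (saturated D A level_value v) i j.
Proof.
move=> pot_v; elim: l => [|l IHl] lk CD i j; first by rewrite Nrem1 finset.setTI.
have [Cl_D C_D] : Ccum A l \subset D /\ Ccrit A l.+1 \subset D.
  by split; apply: fintype.subset_trans CD;
    rewrite CcumS ?finset.subsetUl ?finset.subsetUr.
move=> ij; apply: (IHl (ltnW lk) Cl_D); apply: tclosure_sub ij => x y.
case/and3P; rewrite NremS AmatS => xN yN /eqP xy.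
have N_sub : {subset (Nrem A l.+1 :\: Ccrit A l.+1) :&: D
                <= Nrem A l.+1 :&: D}.
  exact/fintype.subsetP/finset.setSI/finset.subsetDl.
apply: schur_saturated (N_sub _ xN) (N_sub _ yN) xy.
- by apply/fintype.subsetP; rewrite finset.subsetI Ccrit_sub.
- by apply: level_value_Ccrit; apply: ltnW.
by apply: potentialS (finset.subsetIl _ _) (pot_v _ _); apply: ltnW.
Qed.

(** A node of C_m lies on a critical circuit of the stage m, which is saturated
    for every potential because its weight is the sum of d; it is then unfolded
    down to A. *)
Theorem critical_potential : exists2 v,
  potential [set: 'I_n] A level_value v
  & forall l, (l <= k)%N -> {in Ccum A l, forall x,
      tclosure (saturated (Ccum A l) A level_value v) x x}.
Proof.
have [v pot_v] := level_potential_exists; exists v.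
  case: (posnP k) => [k0|k0]; last by rewrite -Nrem1; apply: (pot_v 1%N).
  move=> x; have := level_gt0 x; have := level_le x; lia.
move=> l lk x; rewrite mem_Ccum // => xl.
have m_bd : (0 < level x <= k)%N by rewrite level_gt0 level_le.
have [c [xc cC wc]] : exists c, [/\ x \in c, {subset c <= Ccrit A (level x)}
    & weight (Amat A (level x)) c = (\sum_(j <- c) alpha A (level x))%:E].
  by apply: critical_node_circuit (rho_min_alpha m_bd) _ _; rewrite -/(Ccrit _ _) mem_Ccrit.
have xm : (level x).-1.+1 = level x by rewrite prednK ?level_gt0.
have C_sub m : (m <= l)%N -> Ccum A m \subset Ccum A l.
  move=> ml; apply/fintype.subsetP => y.
  by rewrite !mem_Ccum // ?(leq_trans ml) // => /leq_trans; apply.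
apply: (saturated_descent pot_v (l := (level x).-1)); rewrite ?xm ?level_le //.
  by apply: C_sub; rewrite (leq_trans (leq_pred _)).
apply: (cycle_tclosure _ xc); apply/weight_tight.
- by apply: potentialS (finset.subsetIl _ _) (pot_v _ _).
- move=> y /cC yC; rewrite inE (fintype.subsetP (Ccrit_sub _)) //.
  by move: yC; rewrite mem_Ccrit // mem_Ccum // => /eqP ->.
rewrite wc; congr _%:E; apply: eq_big_seq => y /cC yC.
by rewrite (level_value_Ccrit m_bd).
Qed.

End Stages.

(** * Disjoint circuit covers as permutations *)

Section CoversAndPermutations.
Variable T : finType.
Implicit Types (G : digraph T) (c : seq T) (cs : seq (seq T)) (s : {perm T}).

Lemma cycle_perm c : uniq c -> exists2 s : {perm T},
  perm_on [set x in c] s & {in c, forall x, s x = next c x}.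
Proof.
move=> c_uniq; exists (perm (can_inj (prev_next c_uniq))); last first.
  by move=> x _; rewrite permE.
apply/fintype.subsetP => x; rewrite !inE permE; apply: contraR => xc.
by rewrite next_nth (negPf xc).
Qed.

(** The permutation is the product of the disjoint cycles. *)
Lemma cover_perm G cs : all (circuit G) cs -> uniq (flatten cs) ->
  exists2 s : {perm T}, perm_on [set x in flatten cs] s
    & {in flatten cs, forall x, arcs G x (s x)}.
Proof.
elim: cs => [|c cs IHcs] /=.
  by move=> _ _; exists 1%g => //; apply: perm_on1.
case/andP=> /and3P[_ _ cc] cs_circ; rewrite cat_uniq => /and3P[c_uniq c_cs cs_uniq].
have [t t_on t_arc] := IHcs cs_circ cs_uniq.
have [s s_on s_next] := cycle_perm c_uniq.
exists (s * t)%g => [|x].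
  apply: perm_onM.
    by apply: fintype.subset_trans s_on _; apply/fintype.subsetP => x;
      rewrite !inE mem_cat => ->.
  by apply: fintype.subset_trans t_on _; apply/fintype.subsetP => x;
    rewrite !inE mem_cat orbC => ->.
rewrite mem_cat permM => /orP[xc|xcs].
  rewrite s_next // (out_perm t_on); first exact: next_cycle.
  rewrite inE; apply: contra c_cs => ncs; apply/hasP.
  by exists (next c x) => //; rewrite /= mem_next.
rewrite (out_perm s_on) ?t_arc // inE; apply: contra c_cs => xc.
by apply/hasP; exists x.
Qed.

(** The circuits are the orbits of s in D. *)
Lemma perm_cover s (D : {set T}) : {in D, forall x, s x \in D} ->
  exists cs, [/\ all (fun c => (c != [::]) && fcycle s c) cs,
                 uniq (flatten cs) & flatten cs =i D].
Proof.
have [m] := ubnP #|D|; elim: m D => // m IHm D Dm sD.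
have [->|/set0Pn[x xD]] := eqVneq D finset.set0.
  by exists [::]; split=> // x; rewrite !inE.
have s_inj : injective s by apply: perm_inj.
have orbD y : y \in orbit s x -> y \in D.
  rewrite -fconnect_orbit => /iter_findex <-.
  by elim: (findex _ _ _) => //= i; apply: sD.
pose D' := D :\: [set y in orbit s x].
have [||cs [cs_cyc cs_uniq csD]] := IHm D'.
- rewrite -ltnS (leq_trans _ Dm) // ltnS; apply/proper_card/properP.
  split; first exact: finset.subsetDl.
  by exists x; rewrite ?inE // -fconnect_orbit connect0.
- move=> y; rewrite !inE -!fconnect_orbit => /andP[xy /sD ->]; rewrite andbT.
  apply: contra xy => xsy; apply: connect_trans xsy _.
  by rewrite fconnect_sym // fconnect1.
exists (orbit s x :: cs); split=> /=.
- rewrite cs_cyc cycle_orbit // !andbT.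
  by rewrite -size_eq0 size_orbit -lt0n order_gt0.
- rewrite cat_uniq orbit_uniq cs_uniq andbT /=; apply/hasPn => y.
  by rewrite csD !inE => /andP[].
move=> y; rewrite mem_cat csD !inE.
by have [/orbD ->|] := boolP (y \in orbit s x).
Qed.

End CoversAndPermutations.

(** * Critical circuits and critical graphs *)

Section CriticalGraphs.
Variables (R : realType) (n : nat) (A : 'M[\bar R]_n).
Hypothesis hA : forall i j, A i j != -oo.
Hypothesis hirr : mp_irreducible A.
Hypothesis hn1 : ~ (n = 1%N /\ A = const_mx +oo).
Variable v : 'I_n -> R.
Let k := ncrit A.
Let d := level_value A.
Hypothesis pot : potential [set: 'I_n] A d v.
Hypothesis closed_walks : forall l, (l <= k)%N -> {in Ccum A l, forall x,
  tclosure (saturated (Ccum A l) A d v) x x}.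

(** Order l charges a node of C_m the value alpha_m for m < l and alpha_l
    beyond, so the critical circuits of order l are those of weight the sum of
    alpha_(min(m, l)) over their nodes. *)
Lemma order_weightE l c : (0 < l <= k)%N ->
  order_critical A l c <->
  circuit (mp_graph [set: 'I_n] A) c /\
  weight A c = (\sum_(x <- c) alpha A (minn (level A x) l))%:E.
Proof.
move=> lk.
have arcsE (C : {set 'I_n}) (a : R) :
    (a * (arcs_from C c)%:R = \sum_(x <- c) a * (x \in C)%:R)%R.
  by rewrite arcs_fromE natr_sum mulr_sumr.
have -> : (\sum_(x <- c) alpha A (minn (level A x) l) =
    \sum_(1 <= m < l) alpha A m * (arcs_from (Ccrit A m) c)%:R +
    alpha A l * (arcs_from (Nrem A l) c)%:R)%R.
  under [X in (X + _)%R]eq_bigr do rewrite arcsE.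
  rewrite exchange_big arcsE -big_split /=; apply: eq_bigr => x _.
  rewrite mem_Nrem //; have x0 := level_gt0 A x.
  have -> : (\sum_(1 <= m < l) alpha A m * (x \in Ccrit A m)%:R =
      \sum_(1 <= m < l | m == level A x) alpha A m)%R.
    rewrite [RHS]big_mkcond; apply: eq_big_nat => m ml.
    rewrite mem_Ccrit // ?(eq_sym m); last by move: lk ml; rewrite -/k; lia.
    by case: eqP; rewrite ?mulr1 ?mulr0.
  case: (ltnP (level A x) l) => lx.
    by rewrite big_nat1_eq x0 lx mulr0 addr0.
  by rewrite big_nat1_eq x0 ltnNge lx mulr1 add0r.
have subE (w : \bar R) (x y : R) : w - x%:E = y%:E <-> w = (x + y)%:E.
  case: w => [w| |] //=; rewrite -EFinB.
  by split=> -[wxy]; congr _%:E; [rewrite -wxy | rewrite wxy]; ring.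
by rewrite /order_critical /order_weight; split=> -[circ /subE wE].
Qed.

(** Since alpha_(min(m, l)) is at most alpha_m, strictly for m > l, a circuit
    whose weight is the sum of the former is saturated and cannot leave C^l. *)
Lemma order_criticalP l c : (0 < l <= k)%N ->
  order_critical A l c <->
  c != [::] /\ cycle (saturated (Ccum A l) A d v) c.
Proof.
move=> lk; have lk' : (l <= k)%N by case/andP: lk.
have pot_l : potential (Ccum A l) A d v by apply: potentialS pot.
rewrite order_weightE //; split=> [[circ wE]|[c0 cc]].
  have /and3P[c0 _ _] := circ.
  have c_T : {subset c <= [set: 'I_n]} by move=> x _; rewrite inE.
  have le_d x : (alpha A (minn (level A x) l) <= d x)%R.
    apply: alpha_le => //; last by rewrite geq_minl level_le.
    by rewrite leq_min level_gt0 //; case/andP: lk.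
  have d_le : (\sum_(x <- c) d x <= \sum_(x <- c) alpha A (minn (level A x) l))%R.
    by rewrite -lee_fin -wE; apply: weight_ge pot _ c_T.
  have c_l : {subset c <= Ccum A l}.
    have dE : {in c, forall x, (d x)%:E = (alpha A (minn (level A x) l))%:E}.
      apply: lee_sum_tight => [x _|]; first by rewrite lee_fin.
      by rewrite sumEFin lee_fin.
    move=> x /dE[dx]; rewrite mem_Ccum // leqNgt; apply/negP => lx.
    have : (alpha A l < d x)%R.
      by apply: alpha_lt; rewrite ?lx ?level_le //; case/andP: lk.
    by rewrite dx (minn_idPr (ltnW lx)) ltxx.
  split=> //; apply/(weight_tight pot_l c_l); rewrite wE; congr _%:E.
  apply: eq_big_seq => x /c_l; rewrite mem_Ccum // => xl.
  by rewrite (minn_idPl xl).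
have c_l := sat_cycle_subset cc.
split.
  apply: (@sat_circuit _ _ _ _ d v) => //.
  by apply: sub_cycle cc => x y /and3P[_ _]; rewrite /saturated !inE.
move/(weight_tight pot_l c_l): cc => ->; congr _%:E.
apply: eq_big_seq => x /c_l; rewrite mem_Ccum // => xl.
by rewrite (minn_idPl xl).
Qed.

Lemma critical_graph_nodes l : (l <= k)%N -> nodes (critical_graph A l) = Ccum A l.
Proof.
case: l => // l lk; apply/setP => x; rewrite inE.
have lk0 : (0 < l.+1 <= k)%N by [].
apply/asboolP/idP => [[c /(order_criticalP _ lk0)[_ cc] xc]|xl].
  exact: sat_cycle_subset cc _ xc.
have /tclosure_cycle[c cc xc] := closed_walks lk xl; exists c => //.
by apply/order_criticalP => //; split=> //; case: c xc {cc}.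
Qed.

Lemma disjoint_circuit_coverP l : (l <= k)%N ->
  disjoint_circuit_cover (critical_graph A l) <->
  exists2 s : {perm 'I_n}, perm_on (Ccum A l) s
    & {in Ccum A l, forall x, A x (s x) = (d x + v (s x) - v x)%:E}.
Proof.
move=> lk; split.
  case=> cs [cs_circ cs_uniq cs_cover].
  have [s s_on s_arc] := cover_perm cs_circ cs_uniq.
  have csE : [set x in flatten cs] = Ccum A l.
    rewrite -critical_graph_nodes //; apply/setP => x; rewrite inE.
    apply/idP/idP => [/flattenP[c /(allP cs_circ)/and3P[_ /allP cG _] /cG //]|].
    exact: cs_cover.
  exists s => [|x]; first by rewrite -csE.
  rewrite -csE inE => /s_arc; case: l lk {cs_circ cs_cover csE s_arc} => // l lk.
  case/asboolP=> c /(order_criticalP _ (lk : 0 < l.+1 <= k)%N)[_].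
  by rewrite cycle_arcsE => /allP cc /cc /and3P[_ _ /eqP].
case=> s s_on sE.
have sD : {in Ccum A l, forall x, s x \in Ccum A l} by move=> x; rewrite perm_closed.
have [cs [cs_cyc cs_uniq csD]] := perm_cover sD.
exists cs; split=> //; last by move=> x; rewrite critical_graph_nodes // csD.
apply/allP => c c_cs; have /andP[c0 sc] := allP cs_cyc c c_cs.
have c_l : {subset c <= Ccum A l}.
  by move=> x xc; rewrite -csD; apply/flattenP; exists c.
have cc : cycle (saturated (Ccum A l) A d v) c.
  apply: (sub_in_cycle (P := mem (Ccum A l))) sc => [x y xl _ /eqP <-|].
    by rewrite /saturated xl sD // sE // eqxx.
  by apply/allP.
apply/and3P; split=> //; first by rewrite critical_graph_nodes //; apply/allP.
case: l lk {s_on sE sD csD} c_l cc => [|l] lk c_l cc.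
  by case: c c0 c_l {c_cs sc cc} => // x c _ /(_ x (mem_head _ _)); rewrite inE.
rewrite cycle_arcsE; apply/allP => a ac; apply/asboolP; exists c.
  exact/order_criticalP.
by rewrite -surjective_pairing.
Qed.

Lemma sum_perm_potential (J : {set 'I_n}) (s : {perm 'I_n}) : perm_on J s ->
  (\sum_(x <- enum J) (d x + v (s x) - v x) = \sum_(x in J) d x)%R.
Proof.
move=> s_on; rewrite big_enum /= !big_split /= sumrN.
rewrite [X in (_ - X)%R](reindex_inj (@perm_inj _ s)) /=.
under [X in (_ - X)%R]eq_bigl => x do rewrite perm_closed //.
by rewrite addrK.
Qed.

Lemma perm_weight_ge (J : {set 'I_n}) (s : {perm 'I_n}) : perm_on J s ->
  (\sum_(x in J) d x)%:E <= \sum_(x in J) A x (s x).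
Proof.
move=> s_on; rewrite -(sum_perm_potential s_on) -big_enum /=.
by apply: lee_sum_fin => x _; apply: pot; rewrite inE.
Qed.

(** A permutation of C^l weighs at least the sum of d, so saturation of all
    its arcs amounts to a single upper bound on its weight. *)
Lemma cover_perm_weight l : (l <= k)%N ->
  disjoint_circuit_cover (critical_graph A l) <->
  exists2 s : {perm 'I_n}, perm_on (Ccum A l) s
    & \sum_(x in Ccum A l) A x (s x) <= (\sum_(x in Ccum A l) d x)%:E.
Proof.
move=> lk; rewrite disjoint_circuit_coverP //.
split=> -[s s_on sw]; exists s => //; move: sw;
  rewrite -(sum_perm_potential s_on) -[X in X <= _]big_enum /=.
  move=> sE; rewrite -sumEFin le_eqVlt; apply/orP; left; apply/eqP.
  by apply: eq_big_seq => x; rewrite mem_enum; apply: sE.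
move=> sw; have tight := lee_sum_tight _ sw.
by move=> x xl; apply: tight; rewrite ?mem_enum // => y _; apply: pot; rewrite inE.
Qed.

End CriticalGraphs.

(** * The characteristic polynomial function *)

Section CharacteristicPolynomial.
Variables (R : realType) (n : nat) (A : 'M[\bar R]_n).
Implicit Types (J : {set 'I_n}) (s : {perm 'I_n}) (y : R).

Definition charpoly_eval y : \bar R :=
  \big[mine/+oo]_(k < n.+1) (charpoly_coef A k + (k%:R * y)%:E).

Lemma charpoly_coef_top : charpoly_coef A n = 0.
Proof.
rewrite /charpoly_coef subnn.
rewrite (big_pred1 finset.set0) => [|J]; last by rewrite cards_eq0.
rewrite (big_pred1 (1%g : {perm 'I_n})) ?big_set0 // => s; apply/idP/eqP => [s_on|->].
  by apply/permP => x; rewrite perm1 (out_perm s_on) ?inE.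
exact: perm_on1.
Qed.

Lemma charpoly_eval_le J s y : perm_on J s ->
  charpoly_eval y <= \sum_(x in J) A x (s x) + ((n - #|J|)%:R * y)%:E.
Proof.
move=> s_on; have kn : (n - #|J| < n.+1)%N by rewrite ltnS leq_subr.
have Jn : (#|J| <= n)%N by rewrite -[X in (_ <= X)%N](card_ord n) max_card.
apply: (@bigmin_inf _ _ _ _ (Ordinal kn)) => //=; apply: leeD2r.
apply: (@bigmin_inf _ _ _ _ J); first by rewrite subKn.
exact: bigmin_le_cond.
Qed.

Lemma charpoly_eval_attained y : charpoly_eval y = +oo \/
  exists J s, perm_on J s /\
    charpoly_eval y = \sum_(x in J) A x (s x) + ((n - #|J|)%:R * y)%:E.
Proof.
rewrite /charpoly_eval.
case: (@bigmine_attained R 'I_n.+1 xpredT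
  (fun k : 'I_n.+1 => charpoly_coef A k + (k%:R * y)%:E)) => [|[k _ ->]]; first by left.
rewrite /charpoly_coef; case: (@bigmine_attained R {set 'I_n}
  (fun J => #|J| == (n - k)%N) (fun J => \big[mine/+oo]_(s : {perm 'I_n} |
     perm_on J s) \sum_(j in J) A j (s j))) => [->|[J /eqP Jk ->]].
  by left; rewrite addye.
case: (@bigmine_attained R {perm 'I_n} (fun s => perm_on J s)
  (fun s => \sum_(j in J) A j (s j))) => [->|[s s_on ->]].
  by left; rewrite addye.
right; exists J, s; split=> //; rewrite Jk subKn //.
by rewrite -ltnS.
Qed.

End CharacteristicPolynomial.

(** * Partial sums of the roots *)

Section Roots.
Variables (R : realType) (n : nat) (gamma : 'I_n -> \bar R).
Hypothesis gamma_ninfty : forall i, gamma i != -oo.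
Hypothesis gamma_sorted : forall i j : 'I_n, (i <= j)%N -> gamma i <= gamma j.

Definition roots_eval (y : R) : \bar R := \sum_(i < n) mine y%:E (gamma i).

Definition roots_sum (c : nat) : \bar R := \sum_(j < n | (j < c)%N) gamma j.

Lemma sum_tail_const (c : nat) (y : R) :
  \sum_(j < n | ~~ (j < c)%N) y%:E = ((n - c)%:R * y)%:E.
Proof.
rewrite sumEFin; congr _%:E; under eq_bigl do rewrite -leqNgt.
by rewrite -(big_geq_mkord _ _ xpredT (fun=> y)) sumr_const_nat mulr_natl.
Qed.

Lemma roots_eval_le c y : roots_eval y <= roots_sum c + ((n - c)%:R * y)%:E.
Proof.
rewrite /roots_eval (bigID (fun j : 'I_n => (j < c)%N)) /= -sum_tail_const.
by apply: leeD; apply: lee_sum => j _; rewrite ge_min lexx ?orbT.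
Qed.

Lemma roots_eval_eq c y :
  (forall j : 'I_n, (j < c)%N -> gamma j <= y%:E) ->
  (forall j : 'I_n, (c <= j)%N -> y%:E <= gamma j) ->
  roots_eval y = roots_sum c + ((n - c)%:R * y)%:E.
Proof.
move=> lo hi; rewrite /roots_eval (bigID (fun j : 'I_n => (j < c)%N)) /=.
rewrite -sum_tail_const; congr (_ + _); apply: eq_bigr => j jc.
  by apply: min_idPr; apply: lo.
by apply: min_idPl; apply: hi; rewrite leqNgt.
Qed.

(** At y = gamma_c, the last of the c roots, roots_eval y is the sum of these
    roots plus (n - c) y.  That root cannot be infinite: otherwise roots_eval
    would have slope at least n - c + 1 at infinity. *)
Lemma roots_sum_le c (r : R) : (0 < c <= n)%N ->
  (forall y, roots_eval y <= (r + (n - c)%:R * y)%:E) -> roots_sum c <= r%:E.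
Proof.
case: c => // c /= cn eval_le; pose j0 : 'I_n := Ordinal cn.
case g : (gamma j0) => [y| |]; last by have := gamma_ninfty j0; rewrite g.
  have := eval_le y; rewrite (@roots_eval_eq c.+1).
  - by rewrite EFinD leeD2rE.
  - by move=> j jc; rewrite -g; apply: gamma_sorted.
  - by move=> j jc; rewrite -g; apply: gamma_sorted; apply: ltnW.
pose S0 := (\sum_(j < n | (j < c)%N) fine (mine 0%:E (gamma j)))%R.
have low (y : R) : (0 <= y)%R -> (S0 + (n - c)%:R * y)%:E <= roots_eval y.
  move=> y0; rewrite /roots_eval (bigID (fun j : 'I_n => (j < c)%N)) /=.
  rewrite EFinD -sum_tail_const /S0 -sumEFin.
  apply: leeD; apply: lee_sum => j jc.
    rewrite fineK; last first.
      have := gamma_ninfty j; case: (gamma j) => [x| |] // _.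
        by rewrite -EFin_min.
      by rewrite (min_idPl (leey _)).
    by rewrite le_min !ge_min lee_fin y0 lexx orbT.
  rewrite le_min lexx (_ : gamma j = +oo) ?leey //.
  by apply/eqP; rewrite -leye_eq -g; apply: gamma_sorted; rewrite /= leqNgt.
(* With c + 1 roots, of which the last is infinite, the two bounds on
   roots_eval y give S0 + y <= r for all y >= 0; this y violates it. *)
pose y : R := (`|r - S0| + 1)%R.
have y0 : (0 <= y)%R by rewrite addr_ge0.
have := le_trans (low y y0) (eval_le y); rewrite lee_fin.
rewrite -(subnSK cn) -natr1 mulrDl mul1r.
have : (r - S0 + 1 <= y)%R by rewrite lerD2r ler_norm.
by move=> y_le le_y; exfalso; clear g; lra.
Qed.

End Roots.

(** * Partial sums of the critical values *)

Section CriticalValueSequence.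
Variables (R : realType) (n : nat) (A : 'M[\bar R]_n).
Hypothesis hA : forall i j, A i j != -oo.
Hypothesis hirr : mp_irreducible A.
Hypothesis hn1 : ~ (n = 1%N /\ A = const_mx +oo).
Let k := ncrit A.
Let d := level_value A.

Let values m := flatten [seq nseq #|Ccrit A l| (alpha A l) | l <- iota 1 m].

Let valuesS m : values m.+1 = values m ++ nseq #|Ccrit A m.+1| (alpha A m.+1).
Proof.
have iotaS : iota 1 m.+1 = iota 1 m ++ [:: m.+1].
  by rewrite -[in LHS](addn1 m) iotaD add1n.
by rewrite /values iotaS map_cat flatten_cat /= cats0.
Qed.

Let Ccrit_disjoint m : [disjoint Ccum A m & Ccrit A m.+1].
Proof.
rewrite disjoint_sym; apply/pred0P => x /=; apply/negP => /andP[xC xl].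
by have := fintype.subsetP (Ccrit_sub A m.+1) x xC; rewrite inE /= xl.
Qed.

Let card_CcumS m : #|Ccum A m.+1| = (#|Ccum A m| + #|Ccrit A m.+1|)%N.
Proof.
rewrite CcumS cardsU (_ : Ccum A m :&: _ = finset.set0) ?cards0 ?subn0 //.
by apply/finset.disjoint_setI0.
Qed.

Let size_values m : size (values m) = #|Ccum A m|.
Proof.
elim: m => [|m IHm]; first by rewrite /= cards0.
by rewrite valuesS size_cat size_nseq IHm card_CcumS.
Qed.

Let values_prefix m : (m <= k)%N -> exists t, critical_values A = values m ++ t.
Proof.
move=> mk; exists (flatten [seq nseq #|Ccrit A l| (alpha A l) |
   l <- iota m.+1 (k - m)]).
rewrite /critical_values -/(ncrit A) -/k -{1}(subnKC mk) iotaD add1n.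
by rewrite map_cat flatten_cat.
Qed.

Lemma card_Ccum_le m : (#|Ccum A m| <= n)%N.
Proof. by rewrite -[X in (_ <= X)%N](card_ord n) max_card. Qed.

Lemma nth_critical_values l j : (0 < l <= k)%N ->
  (#|Ccum A l.-1| <= j < #|Ccum A l|)%N ->
  nth 0%R (critical_values A) j = alpha A l.
Proof.
case: l => // l /= lk; rewrite -!size_values => /andP[lj jl].
have [t ->] := values_prefix lk; rewrite nth_cat jl valuesS nth_cat ltnNge lj /=.
by rewrite nth_nseq ltn_subLR // -(size_nseq #|Ccrit A l.+1| (alpha A l.+1))
  -size_cat -valuesS jl.
Qed.

Lemma sum_critical_values m : (m <= k)%N ->
  (\sum_(j < n | (j < #|Ccum A m|)%N) nth 0 (critical_values A) j =
   \sum_(x in Ccum A m) d x)%R.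
Proof.
move=> mk; have [t ->] := values_prefix mk.
rewrite -(big_ord_widen _ (fun j => nth 0%R (values m ++ t) j) (card_Ccum_le m)).
rewrite -size_values.
transitivity (\sum_(y <- values m) y)%R.
  rewrite (big_nth 0%R) big_mkord; apply: eq_bigr => j _.
  by rewrite nth_cat ltn_ord.
elim: m {t} mk => [|m IHm] mk; first by rewrite /values /= big_nil big_set0.
rewrite valuesS big_cat CcumS IHm ?(ltnW mk) //=.
rewrite [RHS](eq_bigl [predU Ccum A m & Ccrit A m.+1]); last first.
  by move=> x; rewrite finset.in_setU.
rewrite [RHS]bigU /=; last exact: Ccrit_disjoint.
congr (_ + _)%R.
rewrite big_nseq iter_addr_0 -sumr_const; apply: eq_bigr => x xC.
by rewrite /d (level_value_Ccrit hA hirr hn1 _ xC).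
Qed.

End CriticalValueSequence.

(** * Comparing roots and critical values *)

Section Comparison.
Variables (R : realType) (n : nat) (A : 'M[\bar R]_n) (gamma : 'I_n -> \bar R).
Hypothesis hA : forall i j, A i j != -oo.
Hypothesis hirr : mp_irreducible A.
Hypothesis hn1 : ~ (n = 1%N /\ A = const_mx +oo).
Hypothesis hgamma : charpoly_roots A gamma.
Variable v : 'I_n -> R.
Let k := ncrit A.
Let d := level_value A.
Let Dsum m : R := (\sum_(x in Ccum A m) d x)%R.
Hypothesis pot : potential [set: 'I_n] A d v.
Hypothesis closed_walks : forall l, (l <= k)%N -> {in Ccum A l, forall x,
  tclosure (saturated (Ccum A l) A d v) x x}.

Let evalE y : charpoly_eval A y = roots_eval gamma y.
Proof. by case: hgamma => _ _ /(_ y); rewrite charpoly_coef_top add0e. Qed.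

Let selection (J : {set 'I_n}) (y : R) : R :=
  (\sum_x if x \in J then d x else y)%R.

Let selectionE (J : {set 'I_n}) y :
  (\sum_(x in J) d x + (n - #|J|)%:R * y = selection J y)%R.
Proof.
rewrite /selection [RHS](bigID (mem J)) /=; congr (_ + _)%R.
  by apply: eq_bigr => x ->.
have -> : (n - #|J|)%N = #|~: J| by rewrite [in RHS]cardsCs finset.setCK card_ord.
rewrite mulr_natl -sumr_const; apply: eq_big => x; rewrite ?inE // => /negbTE -> //.
Qed.

Let selection_min (J : {set 'I_n}) m y :
  (forall x, if x \in Ccum A m then d x <= y else y <= d x)%R ->
  forall x, ((if x \in Ccum A m then d x else y) <= if x \in J then d x else y)%R.
Proof. by move=> sep x; have := sep x; do 2 case: ifP. Qed.

(** At such a y the set C^m realizes the sum of the min(y, d x), a lower bound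
    for every selection of a set J. *)
Lemma roots_eval_ge m y :
  (forall x, if x \in Ccum A m then d x <= y else y <= d x)%R ->
  (Dsum m + (n - #|Ccum A m|)%:R * y)%:E <= roots_eval gamma y.
Proof.
move=> sep; rewrite -evalE.
have [->|[J [s [s_on ->]]]] := charpoly_eval_attained A y; first exact: leey.
apply: le_trans (leeD (perm_weight_ge pot s_on) (lexx _)); rewrite -EFinD lee_fin.
by rewrite /Dsum !selectionE; apply: ler_sum => x _; apply: selection_min.
Qed.

Lemma level_separator m : (m <= k)%N ->
  exists y, forall x, (if x \in Ccum A m then d x < y else y < d x)%R.
Proof.
move=> mk; have [mk'|km] := ltnP m k; last first.
  have [K K_ub] := finite_ub d; exists (K + 1)%R => x.
  rewrite mem_Ccum // (leq_trans (level_le A x)) //; have := K_ub x; lra.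
have [m0|m0] := posnP m.
  exists (alpha A 1 - 1)%R => x; rewrite mem_Ccum // m0 leqNgt level_gt0 /=.
  have : (alpha A 1 <= d x)%R by apply: alpha_le; rewrite ?level_gt0 ?level_le.
  lra.
have lt_m : (alpha A m < alpha A m.+1)%R by apply: alphaS_gt => //; rewrite m0.
exists ((alpha A m + alpha A m.+1) / 2)%R => x; rewrite mem_Ccum //.
case: leqP => xm.
  have : (d x <= alpha A m)%R by apply: alpha_le; rewrite ?level_gt0 ?xm.
  lra.
have : (alpha A m.+1 <= d x)%R by apply: alpha_le; rewrite ?xm ?level_le.
lra.
Qed.

(** From sums to covers, evaluate at a y that strictly separates the values of d
    on C^m from the others: an optimal pair (J, s) must have J = C^m, and s is
    then tight.  From covers to sums, the permutation bounds the function by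
    the line of slope n - #C^m for all y at once. *)
Lemma roots_sum_cover m : (m <= k)%N ->
  roots_sum gamma #|Ccum A m| = (Dsum m)%:E <->
  disjoint_circuit_cover (critical_graph A m).
Proof.
move=> mk; rewrite (cover_perm_weight hA hirr hn1 pot closed_walks mk).
have [g_ninfty g_sorted _] := hgamma.
have [y sep] := level_separator mk.
have sepW x : (if x \in Ccum A m then d x <= y else y <= d x)%R.
  by have := sep x; case: ifP => _ /ltW.
split=> [sumE|[s s_on sw]].
  have := roots_eval_le gamma #|Ccum A m| y; rewrite sumE -evalE.
  have [-> //|[J [s [s_on ->]]]] := charpoly_eval_attained A y.
  rewrite -EFinD => upper.
  have JE : J = Ccum A m.
    have := le_trans (leeD (perm_weight_ge pot s_on) (lexx _)) upper.
    rewrite -EFinD lee_fin /Dsum !selectionE -subr_le0 -sumrB => le0.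
    have term_ge0 x : (0 <= (if x \in J then d x else y) -
        (if x \in Ccum A m then d x else y))%R.
      by rewrite subr_ge0; apply: selection_min.
    have /eqP : (\sum_x ((if x \in J then d x else y) -
        (if x \in Ccum A m then d x else y)) = 0)%R.
      by apply/le_anti; rewrite le0 sumr_ge0.
    rewrite psumr_eq0 // => /allP eq0; apply/setP => x.
    have := eq0 x (mem_index_enum x); have := sep x.
    case: (x \in Ccum A m); case: (x \in J) => //= lt_x /eqP; lra.
  exists s; first by rewrite -JE.
  by move: upper; rewrite JE EFinD leeD2rE.
have le_sum y' : roots_eval gamma y' <=
    (Dsum m + (n - #|Ccum A m|)%:R * y')%:E.
  rewrite -evalE EFinD; apply: le_trans (charpoly_eval_le A y' s_on) _.
  exact: leeD2r.
apply/le_anti/andP; split.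
  have [c0|c0] := posnP #|Ccum A m|.
    by rewrite /roots_sum /Dsum (cards0_eq c0) big_set0 cards0 big_pred0.
  by apply: roots_sum_le le_sum; rewrite ?c0 ?card_Ccum_le.
have := le_trans (roots_eval_ge sepW) (roots_eval_le gamma #|Ccum A m| y).
by rewrite EFinD leeD2rE.
Qed.

(** Evaluation at alpha_l bounds the sum of one more root from below. *)
Lemma next_root_ge l : (0 < l <= k)%N ->
  roots_sum gamma #|Ccum A l.-1| = (Dsum l.-1)%:E ->
  forall j : 'I_n, (#|Ccum A l.-1| <= j)%N -> (alpha A l)%:E <= gamma j.
Proof.
case: l => // l /= lk sumE j lj; have [g_ninfty g_sorted _] := hgamma.
set c := #|Ccum A l| in lj sumE *; have cn : (c < n)%N by apply: leq_ltn_trans lj _.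
apply: le_trans (g_sorted (Ordinal cn) j lj).
have sep x : (if x \in Ccum A l then d x <= alpha A l.+1 else alpha A l.+1 <= d x)%R.
  rewrite mem_Ccum ?(ltnW lk) //; case: leqP => xl.
    by apply: alpha_le; rewrite ?level_gt0 ?(leq_trans xl) ?lk.
  by apply: alpha_le; rewrite ?xl ?level_le.
have := le_trans (roots_eval_ge sep) (roots_eval_le gamma c.+1 (alpha A l.+1)).
have -> : roots_sum gamma c.+1 = (Dsum l)%:E + gamma (Ordinal cn).
  rewrite -sumE /roots_sum (bigD1 (Ordinal cn)) /= ?ltnSn // addeC; congr (_ + _).
  apply: eq_bigl => i; rewrite ltnS -val_eqE /=; lia.
have -> : (Dsum l + (n - #|Ccum A l|)%:R * alpha A l.+1 =
    Dsum l + alpha A l.+1 + (n - c.+1)%:R * alpha A l.+1)%R.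
  by rewrite -/c -(subnSK cn) -natr1; ring.
by rewrite EFinD leeD2rE // EFinD leeD2lE.
Qed.

End Comparison.

(** * The equivalence *)

Theorem theorem4p7 (R : realType) (n : nat) (A : 'M[\bar R]_n)
    (gamma : 'I_n -> \bar R) (l : nat)
    (hA : forall i j, A i j != -oo)
    (hirr : mp_irreducible A)
    (hn1 : ~ (n = 1%N /\ A = const_mx +oo))
    (hgamma : charpoly_roots A gamma)
    (hl : (1 <= l <= ncrit A)%N) :
  let beta j := nth 0%R (critical_values A) j in
  ((forall j : 'I_n, (#|Ccum A l.-1| <= j < #|Ccum A l|)%N ->
      gamma j = (beta j)%:E) /\
   \sum_(j < n | (j < #|Ccum A l.-1|)%N) gamma j =
     (\sum_(j < n | (j < #|Ccum A l.-1|)%N) beta j)%R%:E)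
  <->
  (disjoint_circuit_cover (critical_graph A l.-1) /\
   disjoint_circuit_cover (critical_graph A l)).
Proof.
move=> beta; have [v pot closed_walks] := critical_potential hA hirr hn1.
have lk : (l <= ncrit A)%N by case/andP: hl.
have l1k : (l.-1 <= ncrit A)%N by rewrite (leq_trans (leq_pred _)).
rewrite -!(roots_sum_cover hA hirr hn1 hgamma pot closed_walks) //.
rewrite -!sum_critical_values // -/(roots_sum gamma #|Ccum A l.-1|).
set a := #|Ccum A l.-1|; set b := #|Ccum A l|.
have ab : (a <= b)%N.
  by apply/subset_leq_card/fintype.subsetP => x; rewrite !mem_Ccum //; lia.
have splitE (V : nmodType) (F : 'I_n -> V) :
    (\sum_(j < n | (j < b)%N) F j =
     \sum_(j < n | (j < a)%N) F j + \sum_(j < n | (a <= j < b)%N) F j)%R.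
  rewrite (bigID (fun j : 'I_n => (j < a)%N)) /=; congr (_ + _)%R;
    apply: eq_bigl => j; lia.
rewrite -/(roots_sum gamma b) /= in splitE *.
split=> [[midE lowE]|[lowE topE]].
  split=> //; rewrite /roots_sum !splitE EFinD -/(roots_sum gamma a) lowE.
  by congr (_ + _); rewrite -sumEFin; apply: eq_bigr => j /midE.
split=> // j abj.
have next := next_root_ge hA hirr hn1 hgamma pot hl.
rewrite -sum_critical_values // in next.
have tight := @lee_sum_tight R 'I_n (enum [pred i : 'I_n | (a <= i < b)%N])
  gamma (fun i => beta i).
apply: tight; last by rewrite mem_enum.
  move=> i; rewrite mem_enum inE => abi.
  rewrite /beta (nth_critical_values hl abi); apply: next => //.
  by case/andP: abi.
rewrite !big_enum /=.
move: topE; rewrite /roots_sum !splitE -/(roots_sum gamma a) lowE EFinD => topE.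
by rewrite -(@leeD2lE _ (\sum_(j < n | (j < a)%N) beta j)%R%:E) // topE.
Qed.
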